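(* There exists an absolute constant $c>0$ such that the following holds. Let $n$ be a non-negative integer and let $X$ be a random variable taking values in $\{0,\ldots,n\}$ with $\mathbb{P}(X=0)\,\mathbb{P}(X=n)>0$ and probability generating function $f_X$. Let $\varepsilon\in(0,1)$, $\delta>0$ and $R\geq1+\varepsilon$. If all zeros $\zeta\in\mathbb{C}$ of $f_X$ satisfy $|\arg(\zeta)|\geq\delta$ and $R^{-1}\leq|\zeta|\leq R$, then $$\mathrm{Var}(X)\geq c\,\max\{\varepsilon,\delta\}\cdot\delta^{-1}R^{-2\pi/\delta}\,n .$$
   Context: For a random variable $X$ with values in $\{0,\ldots,n\}$, its probability generating function is the polynomial $f_X(z)=\sum_{k=0}^n\mathbb{P}(X=k)z^k$, $z\in\mathbb{C}$. For $z\in\mathbb{C}\setminus\{0\}$ write $z=re^{i\theta}$ with $r>0$ and $\theta\in[-\pi,\pi]$; then $\arg(z)=\theta$ (so $|\arg(z)|\in[0,\pi]$ is well defined). *)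

(* Defs.v *)
From HB Require Import structures.
From mathcomp Require Export all_boot all_order all_algebra.
From mathcomp Require Export all_classical all_reals all_analysis.
From mathcomp Require Export complex.

Set Implicit Arguments.
Unset Strict Implicit.
Unset Printing Implicit Defensive.

Import Order.TTheory GRing.Theory Num.Theory.

Local Open Scope classical_set_scope.
Local Open Scope ring_scope.
Local Open Scope complex_scope.

(* [z = r e^(i theta)] with [r > 0], in Cartesian coordinates. *)
Definition polar (R : realType) (z : R[i]) (theta : R) : Prop :=
  exists2 r : R, 0 < r & z = (r * cos theta) +i* (r * sin theta).

(* For a negative real [z] both [pi] and [- pi] qualify and [xget] picks one of
   them; only [`|carg z|] is canonical, see [norm_cargE]. The value at [0] is
   irrelevant. *)
Definition carg (R : realType) (z : R[i]) : R :=
  xget 0 [set theta | - pi <= theta <= pi /\ polar z theta].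

Lemma cargP (R : realType) (z : R[i]) :
  z != 0 -> - pi <= carg z <= pi /\ polar z (carg z).
Proof.
move=> z0; rewrite /carg; case: xgetP => [t _ //|H]; exfalso.
case: z z0 H => a b; rewrite eq_complex /= => ab0 H.
have s0 : 0 < a ^+ 2 + b ^+ 2.
  by rewrite lt_def addr_ge0 ?sqr_ge0// andbT paddr_eq0 ?sqr_ge0// !sqrf_eq0.
pose r := Num.sqrt (a ^+ 2 + b ^+ 2).
have r0 : 0 < r by rewrite sqrtr_gt0.
have r2 : r ^+ 2 = a ^+ 2 + b ^+ 2 by rewrite sqr_sqrtr// ltW.
have ar : -1 <= a / r <= 1.
  rewrite -ler_norml normrM normfV (gtr0_norm r0) ler_pdivrMr// mul1r.
  by rewrite -sqrtr_sqr ler_wsqrtr// lerDl sqr_ge0.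
have cE : r * cos (acos (a / r)) = a.
  by rewrite acosK ?in_itv//= mulrC divfK ?gt_eqF.
have sE : r * sin (acos (a / r)) = `|b|.
  rewrite sin_acos// -[X in X * _](gtr0_norm r0) -sqrtr_sqr -sqrtrM ?sqr_ge0//.
  rewrite mulrBr mulr1 -exprMn (mulrC r) divfK ?gt_eqF// r2 addrAC subrr add0r.
  by rewrite sqrtr_sqr.
have t0 := acos_ge0 ar; have tpi := acos_lepi ar.
have pi0 : 0 <= pi :> R := pi_ge0 R.
case: (lerP 0 b) => b0.
- apply: (H (acos (a / r))); split; first by rewrite tpi andbT (le_trans _ t0)// oppr_le0.
  by exists r => //; rewrite cE sE ger0_norm.
- apply: (H (- acos (a / r))); split.
    by rewrite lerN2 tpi/= (le_trans _ pi0)// oppr_le0.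
  by exists r => //; rewrite cosN sinN mulrN cE sE ltr0_norm// opprK.
Qed.

Lemma norm_cargE (R : realType) (z : R[i]) (theta : R) :
  - pi <= theta <= pi -> polar z theta -> `|carg z| = `|theta|.
Proof.
move=> tpi zt.
have z0 : z != 0.
  case: zt => r r0 ->; apply/eqP => -[] /eqP + /eqP.
  rewrite !mulf_eq0 (gt_eqF r0)/= => /eqP c /eqP s.
  have := cos2Dsin2 theta; rewrite c s expr0n addr0 => /esym/eqP.
  by rewrite oner_eq0.
have [cpi [s s0 zs]] := cargP z0; case: zt => r r0 zr.
have cos_norm (x : R) : cos `|x| = cos x.
  by case: (ger0P x) => // _; rewrite cosN.
apply: cos_inj.
- by rewrite in_itv /= normr_ge0 ler_norml.
- by rewrite in_itv /= normr_ge0 ler_norml.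
rewrite !cos_norm.
have [e1 e2] := etrans (esym zr) zs.
have rs : r = s.
  apply/eqP; rewrite -(@eqrXn2 _ 2%N)// ?ltW//; apply/eqP.
  have sqE (u x : R) : u ^+ 2 = (u * cos x) ^+ 2 + (u * sin x) ^+ 2.
    by rewrite !exprMn -mulrDr cos2Dsin2 mulr1.
  by rewrite (sqE r theta) e1 e2 -sqE.
by move: e1; rewrite rs => /(mulfI (lt0r_neq0 s0)).
Qed.

Definition pgf d (T : measurableType d) (R : realType) (P : probability T R)
    (n : nat) (X : T -> nat) : {poly R[i]} :=
  \poly_(k < n.+1) (fine (P (X @^-1` [set k])))%:C.

(* Main.v *)
Require Import Defs.
From mathcomp Require Import ring lra.
Import Order.TTheory GRing.Theory Num.Theory.
Import numFieldNormedType.Exports.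
Local Open Scope classical_set_scope.
Local Open Scope ring_scope.
Local Open Scope complex_scope.

Set Implicit Arguments.
Unset Strict Implicit.
Unset Printing Implicit Defensive.

(** Write [f] for the generating function and u(x, t) = log |f(e^(x + i t))|.
    Away from the zeros of [f] this is harmonic in (x, t), and it is even in [t]
    since [f] has real coefficients.  On the line t = 0 it is the cumulant
    generating function of [X]: u_x(x, 0) and V(x) = u_xx(x, 0) are the mean and
    the variance of [X] tilted by e^(x X), and V(0) is the variance to be bounded.

    The whole argument is a comparison of V(0) with the growth of the tilted mean.
    Over [-L, L], where L is at least log R, each zero raises u_x by at least
    (e^L - 1) / (2 (e^L + 1)) ([slope_increment_ge]), so the integral of [V] over
    [-L, L] is of order at least n min(1, L).  On the other hand [V] obeys a Harnack
    inequality with a sharp rate ([curvature_harnack]),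
        V(x) <= e^(2 pi |x| / delta) V(0),
    so that integral is at most (delta / pi) e^(2 pi L / delta) V(0).  Taking
    L = log R + delta costs only a constant in the exponential, and makes
    e^L - 1 at least max(eps, delta); this is the stated bound.

    The Harnack inequality comes from a fact about a harmonic function [q] on a
    strip 0 <= t <= b which vanishes at t = 0 and is nonnegative at t = b: its
    normal derivative q_t(x, 0) is the integral of the values q(s, b) against a
    multiple of 1 / (1 + ch (pi (x - s) / b)), a positive kernel whose logarithm is
    Lipschitz with constant pi / b ([strip_normal_deriv_ge0], [strip_harnack]).
    It is used twice, with b = delta / 2:
    - for q = u(x, b - t) - u(x, b + t), which at t = b is u(x, 0) - u(x, delta),
      nonnegative because |f(r e^(i t))| <= f(r); the conclusion is
      - u_t(x, b) >= 0;
    - for q = - u_t, which vanishes at t = 0 because [u] is even and is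
      nonnegative at t = b by the first step; its normal derivative is
      - u_tt = u_xx = V.
    To avoid zeros on the boundary the strip is first shrunk a little.

    The fact about the strip is proved without an integral representation.  Green's
    formula pairs [q] with an explicit harmonic kernel on a vertical segment
    ([flux]): as the segment moves, this flux is monotone, and it tends to 0 at
    infinity.  The kernel has a pole at a boundary point; keeping it at distance
    [eta] from the segment gives inequalities between weighted means of q(x, .)
    ([kernel_average_ge0], [kernel_average_harnack]), and letting [eta] tend to 0
    concentrates the weight at t = 0 and turns them into inequalities between normal
    derivatives ([kernel_concentration]).  Both the kernel and [u] are built from the
    same function, the logarithmic potential log (ch x - cos t) of one zero. *)

(** * Derivatives and hyperbolic functions *)

Section derive_rules.
Context {R : realType}.
Implicit Types (f g : R -> R) (x df dg : R).

(** A copy of [is_derive] that is not a class: the rules below are applied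
    backwards with the derivative left open, where instance resolution would
    interfere. *)
Definition has_deriv f x df : Prop := is_derive x 1 f df.

Lemma has_deriv_eq f x df dg : has_deriv f x df -> df = dg -> has_deriv f x dg.
Proof. by move=> H <-. Qed.

Lemma has_deriv_derivable f x df : has_deriv f x df -> derivable f x 1.
Proof. by case. Qed.

Lemma has_deriv_val f x df : has_deriv f x df -> derive1 f x = df.
Proof. by case=> _ <-; rewrite derive1E. Qed.

Lemma has_deriv_unique f x df dg : has_deriv f x df -> has_deriv f x dg -> df = dg.
Proof. by move=> /has_deriv_val <- /has_deriv_val <-. Qed.

Lemma has_deriv_cont f x df : has_deriv f x df -> {for x, continuous f}.
Proof. by move=> /has_deriv_derivable /derivable1_diffP /differentiable_continuous. Qed.

Lemma has_derivD f g x df dg : has_deriv f x df -> has_deriv g x dg ->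
  has_deriv (fun z => f z + g z) x (df + dg).
Proof. by move=> Hf Hg; exact: is_deriveD. Qed.

Lemma has_derivB f g x df dg : has_deriv f x df -> has_deriv g x dg ->
  has_deriv (fun z => f z - g z) x (df - dg).
Proof. by move=> Hf Hg; exact: is_deriveB. Qed.

Lemma has_derivN f x df : has_deriv f x df -> has_deriv (fun z => - f z) x (- df).
Proof. by move=> Hf; exact: is_deriveN. Qed.

Lemma has_derivM f g x df dg : has_deriv f x df -> has_deriv g x dg ->
  has_deriv (fun z => f z * g z) x (df * g x + f x * dg).
Proof.
rewrite /has_deriv => Hf Hg; have := is_deriveM Hf Hg.
by rewrite /GRing.scale /= addrC (mulrC (g x)).
Qed.

Lemma has_derivZ (k : R) f x df : has_deriv f x df ->
  has_deriv (fun z => k * f z) x (k * df).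
Proof. by move=> Hf; exact: is_deriveZ. Qed.

Lemma has_derivV f x df : f x != 0 -> has_deriv f x df ->
  has_deriv (fun z => (f z)^-1) x (- df / f x ^+ 2).
Proof.
move=> fx0 [dfx <-]; split; first exact: derivableV.
by rewrite deriveV// /GRing.scale /= !mulNr mulrC.
Qed.

Lemma has_deriv_div f g x df dg : g x != 0 ->
  has_deriv f x df -> has_deriv g x dg ->
  has_deriv (fun z => f z / g z) x ((df * g x - f x * dg) / g x ^+ 2).
Proof.
move=> gx0 Hf Hg; apply: has_deriv_eq.
  by apply: has_derivM; [exact: Hf|exact: has_derivV Hg].
by rewrite /=; field.
Qed.

Lemma has_derivX f n x df : has_deriv f x df ->
  has_deriv (fun z => f z ^+ n) x (n%:R * f x ^+ n.-1 * df).
Proof. by rewrite -exprfctE => Hf; exact: is_deriveX. Qed.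

Lemma has_deriv_comp f g x df dg : has_deriv f x df ->
  has_deriv g (f x) dg -> has_deriv (fun z => g (f z)) x (df * dg).
Proof.
rewrite /has_deriv => Hf Hg.
by have := @is_derive1_comp R g f x dg df Hg Hf; rewrite mulrC.
Qed.

Lemma has_deriv_cst (k x : R) : has_deriv (fun=> k) x 0.
Proof. exact: is_derive_cst. Qed.

Lemma has_deriv_id (x : R) : has_deriv (fun z => z) x 1.
Proof. exact: is_derive_id. Qed.

Lemma has_deriv_expR (x : R) : has_deriv expR x (expR x).
Proof. exact: is_derive_expR. Qed.

Lemma has_deriv_sin (x : R) : has_deriv sin x (cos x).
Proof. exact: is_derive_sin. Qed.

Lemma has_deriv_cos (x : R) : has_deriv cos x (- sin x).
Proof. exact: is_derive_cos. Qed.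

Lemma has_deriv_ln (x : R) : 0 < x -> has_deriv (@ln R) x x^-1.
Proof. exact: is_derive1_ln. Qed.

End derive_rules.

Section hyperbolic.
Context {R : realType}.
Implicit Types x y : R.

Definition ch x := (expR x + expR (- x)) / 2.
Definition sh x := (expR x - expR (- x)) / 2.

Lemma has_deriv_expRN x : has_deriv (fun z => expR (- z)) x (- expR (- x)).
Proof.
apply: has_deriv_eq.
  exact: has_deriv_comp (has_derivN (has_deriv_id x)) (has_deriv_expR _).
by rewrite /=; ring.
Qed.

Lemma has_deriv_ch x : has_deriv ch x (sh x).
Proof.
apply: has_deriv_eq.
  apply: has_derivM; last exact: has_deriv_cst.
  by apply: has_derivD; [exact: has_deriv_expR|exact: has_deriv_expRN].
by rewrite /sh; ring.
Qed.

Lemma has_deriv_sh x : has_deriv sh x (ch x).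
Proof.
apply: has_deriv_eq.
  apply: has_derivM; last exact: has_deriv_cst.
  by apply: has_derivB; [exact: has_deriv_expR|exact: has_deriv_expRN].
by rewrite /ch; ring.
Qed.

Lemma ch2Bsh2 x : ch x ^+ 2 - sh x ^+ 2 = 1.
Proof.
have := expRxMexpNx_1 x; rewrite /ch /sh => H; by rewrite -[RHS]H; field.
Qed.

Lemma chN x : ch (- x) = ch x. Proof. by rewrite /ch opprK addrC. Qed.
Lemma shN x : sh (- x) = - sh x.
Proof. by rewrite /sh opprK -mulNr opprB. Qed.

Lemma ch_ge1 x : 1 <= ch x.
Proof.
have := ch2Bsh2 x; have : 0 < ch x by rewrite divr_gt0// addr_gt0 ?expR_gt0.
have := sqr_ge0 (sh x); nra.
Qed.

Lemma ch_gt1 x : 0 < x -> 1 < ch x.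
Proof.
move=> x0; have := ch2Bsh2 x; have := ch_ge1 x.
have : 0 < sh x by rewrite divr_gt0// subr_gt0 ltr_expR; lra.
by move: (ch x) (sh x) => a b; nra.
Qed.

Lemma sh_ge0 x : 0 <= x -> 0 <= sh x.
Proof. by move=> x0; rewrite divr_ge0// subr_ge0 ler_expR; lra. Qed.

Lemma le_ch x y : 0 <= x <= y -> ch x <= ch y.
Proof.
move=> /andP[x0 xy]; rewrite /ch ler_pM2r ?invr_gt0//.
have ex := expRxMexpNx_1 x; have ey := expRxMexpNx_1 y.
have : expR x <= expR y by rewrite ler_expR.
have : 1 <= expR x by rewrite -expR0 ler_expR.
have := expR_gt0 (- x); have := expR_gt0 (- y).
move: (expR x) (expR y) (expR (- x)) (expR (- y)) ex ey => a b c d ac bd d0 c0 a1 ab.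
have dc : d <= c by nra.
have : (b - a) >= (b - a) * (c * d) by rewrite ler_piMr; nra.
have -> : (b - a) * (c * d) = c - d by rewrite mulrBl; nra.
lra.
Qed.

Lemma ler_sh_ch x : `|sh x| <= ch x.
Proof.
have := ch2Bsh2 x; have := ch_ge1 x; move: (ch x) (sh x) => a b a1 E.
by rewrite ler_norml; apply/andP; split; nra.
Qed.

Lemma ch_shift_le x h : 0 <= h -> ch (x + h) <= expR h * ch x.
Proof.
move=> h0; rewrite /ch opprD !expRD mulrA ler_pM2r ?invr_gt0// mulrDr.
rewrite (mulrC (expR x)) lerD2l mulrC ler_wpM2r ?expR_ge0//.
by rewrite ler_expR; lra.
Qed.

Lemma ch_ge_half x : 0 <= x -> (1 + x) / 2 <= ch x.
Proof.
move=> x0; rewrite /ch ler_pM2r ?invr_gt0//.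
have := expR_ge1Dx x; have := expR_ge0 (- x); lra.
Qed.

Lemma ch_le_expR x : 0 <= x -> ch x <= expR x.
Proof.
move=> x0; have : expR (- x) <= expR x by rewrite ler_expR; lra.
by rewrite /ch; lra.
Qed.

End hyperbolic.

(** * The logarithmic potential of one zero *)

Section log_potential.
Context {R : realType}.
Implicit Types x t : R.

(** For zeta = e^(y + i phi), the square of |e^(x + i t) - zeta| is
    2 e^(x + y) [gap (x - y) (t - phi)]; hence [lpot] is harmonic, and its partial
    derivatives below close up under the relation lpot_tt = - lpot_xx. *)
Definition gap x t := ch x - cos t.

Definition lpot x t := ln (gap x t).
Definition lpot_x x t := sh x / gap x t.
Definition lpot_t x t := sin t / gap x t.
Definition lpot_xx x t := (1 - ch x * cos t) / gap x t ^+ 2.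
Definition lpot_xt x t := - (sin t * sh x) / gap x t ^+ 2.
Definition lpot_xxt x t :=
  sin t * (ch x ^+ 2 + ch x * cos t - 2) / gap x t ^+ 3.

Lemma gap_gt0 x t : 0 < x -> 0 < gap x t.
Proof. by move=> x0; rewrite subr_gt0 (le_lt_trans (cos_le1 t))// ch_gt1. Qed.

Lemma has_deriv_gap_x x t : has_deriv (gap^~ t) x (sh x).
Proof.
apply: has_deriv_eq; first apply: has_derivB.
- exact: has_deriv_ch.
- exact: has_deriv_cst.
- by rewrite subr0.
Qed.

Lemma has_deriv_gap_t x t : has_deriv (gap x) t (sin t).
Proof.
apply: has_deriv_eq; first apply: has_derivB.
- exact: has_deriv_cst.
- exact: has_deriv_cos.
- by rewrite sub0r opprK.
Qed.

Variables (x t : R).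
Hypothesis gap0 : 0 < gap x t.

Let gap_neq0 : gap x t != 0. Proof. by rewrite gt_eqF. Qed.

Lemma lpot_derive_x : has_deriv (lpot^~ t) x (lpot_x x t).
Proof. exact: (has_deriv_comp (has_deriv_gap_x x t) (has_deriv_ln gap0)). Qed.

Lemma lpot_derive_t : has_deriv (lpot x) t (lpot_t x t).
Proof. exact: (has_deriv_comp (has_deriv_gap_t x t) (has_deriv_ln gap0)). Qed.

Lemma lpot_x_derive_x : has_deriv (lpot_x^~ t) x (lpot_xx x t).
Proof.
apply: has_deriv_eq.
  exact: (has_deriv_div (g := gap^~ t) gap_neq0 (has_deriv_sh x)
    (has_deriv_gap_x x t)).
rewrite /lpot_xx /=.
have : sh x ^+ 2 = ch x ^+ 2 - 1 by rewrite -(ch2Bsh2 x); ring.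
move: gap_neq0; rewrite /gap; move: (ch x) (sh x) (cos t) => C S c g0 H.
by field: H.
Qed.

Lemma lpot_t_derive_t : has_deriv (lpot_t x) t (- lpot_xx x t).
Proof.
apply: has_deriv_eq.
  exact: (has_deriv_div gap_neq0 (has_deriv_sin t) (has_deriv_gap_t x t)).
rewrite /lpot_xx /=.
have : sin t ^+ 2 = 1 - cos t ^+ 2 by rewrite -(cos2Dsin2 t); ring.
move: gap_neq0; rewrite /gap; move: (ch x) (cos t) (sin t) => C c s g0 H.
by field: H.
Qed.

Lemma lpot_t_derive_x : has_deriv (lpot_t^~ t) x (lpot_xt x t).
Proof.
apply: has_deriv_eq.
  exact: (has_deriv_div (g := gap^~ t) gap_neq0 (has_deriv_cst _ x)
    (has_deriv_gap_x x t)).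
by rewrite /lpot_xt /=; field.
Qed.

Lemma lpot_x_derive_t : has_deriv (lpot_x x) t (lpot_xt x t).
Proof.
apply: has_deriv_eq.
  exact: (has_deriv_div gap_neq0 (has_deriv_cst _ t) (has_deriv_gap_t x t)).
by rewrite /lpot_xt /=; field.
Qed.

Lemma lpot_xt_derive_x : has_deriv (lpot_xt^~ t) x (lpot_xxt x t).
Proof.
have gap2 : gap x t ^+ 2 != 0 by rewrite expf_neq0.
apply: has_deriv_eq.
  exact: (has_deriv_div (g := fun z => gap z t ^+ 2) gap2
    (has_derivN (has_derivZ (sin t) (has_deriv_sh x)))
    (has_derivX 2 (has_deriv_gap_x x t))).
rewrite /lpot_xxt /=.
have : sh x ^+ 2 = ch x ^+ 2 - 1 by rewrite -(ch2Bsh2 x); ring.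
move: gap_neq0; rewrite /gap; move: (ch x) (sh x) (cos t) (sin t) => C S c s g0 H.
by field: H.
Qed.

Lemma lpot_xx_derive_t : has_deriv (lpot_xx x) t (lpot_xxt x t).
Proof.
have gap2 : gap x t ^+ 2 != 0 by rewrite expf_neq0.
apply: has_deriv_eq.
  exact: (has_deriv_div (g := fun z => gap x z ^+ 2) gap2
    (has_derivB (has_deriv_cst 1 t) (has_derivZ (ch x) (has_deriv_cos t)))
    (has_derivX 2 (has_deriv_gap_t x t))).
rewrite /lpot_xxt /=.
move: gap_neq0; rewrite /gap; move: (ch x) (cos t) (sin t) => C c s g0.
by field.
Qed.

Lemma lpot_xt_cont_t : {for t, continuous (lpot_xt x)}.
Proof.
have gap2 : gap x t ^+ 2 != 0 by rewrite expf_neq0.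
exact: (has_deriv_cont (has_deriv_div (g := fun z => gap x z ^+ 2) gap2
  (has_derivN (has_derivM (has_deriv_sin t) (has_deriv_cst (sh x) t)))
  (has_derivX 2 (has_deriv_gap_t x t)))).
Qed.

Lemma lpot_xxt_cont_t : {for t, continuous (lpot_xxt x)}.
Proof.
have gap3 : gap x t ^+ 3 != 0 by rewrite expf_neq0.
exact: (has_deriv_cont (has_deriv_div (g := fun z => gap x z ^+ 3) gap3
  (has_derivM (has_deriv_sin t) (has_derivB (has_derivD (has_deriv_cst (ch x ^+ 2) t)
    (has_derivZ (ch x) (has_deriv_cos t))) (has_deriv_cst 2 t)))
  (has_derivX 3 (has_deriv_gap_t x t)))).
Qed.

End log_potential.

(** All derivatives are bounded where [gap] is bounded below: [1 + ch x] is at most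
    a constant times [gap x t], and a derivative with denominator [gap ^+ n] has a
    numerator of size at most [(1 + ch x) ^+ n]. *)
Section bounds.
Context {R : realType}.
Variables (m x t : R).
Hypotheses (m0 : 0 < m) (mgap : m <= gap x t).

Let K := 1 + 2 / m.

Let gap_gt0 : 0 < gap x t. Proof. exact: lt_le_trans mgap. Qed.

Lemma div_gap_bound n (N : R) : `|N| <= (1 + ch x) ^+ n ->
  `|N / gap x t ^+ n| <= K ^+ n.
Proof.
move=> HN; rewrite normrM normfV (gtr0_norm (exprn_gt0 _ gap_gt0)).
rewrite ler_pdivrMr ?exprn_gt0// -exprMn (le_trans HN)// lerXn2r//.
- by rewrite nnegrE; have := ch_ge1 x; lra.
- by rewrite nnegrE mulr_ge0 ?(ltW gap_gt0)// addr_ge0// divr_ge0// ltW.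
rewrite /K mulrDl mul1r /gap.
have : 2 <= 2 / m * gap x t.
  by rewrite -mulrA mulrC ler_pMl// mulrC ler_pdivlMr// mul1r.
by rewrite /gap; move: (2 / m * _) (cos_le1 t) => z; lra.
Qed.

Lemma lpot_x_bound : `|lpot_x x t| <= K.
Proof.
rewrite -[K]expr1 -[lpot_x x t]/(sh x / _ ^+ 1); apply: div_gap_bound.
by have := ler_sh_ch x; rewrite expr1; lra.
Qed.

Lemma lpot_t_bound : `|lpot_t x t| <= K.
Proof.
rewrite -[K]expr1 -[lpot_t x t]/(sin t / _ ^+ 1); apply: div_gap_bound.
by have := sin_max t; have := ch_ge1 x; rewrite expr1; lra.
Qed.

Lemma lpot_xx_bound : `|lpot_xx x t| <= K ^+ 2.
Proof.
apply: div_gap_bound; have := cos_geN1 t; have := cos_le1 t; have := ch_ge1 x.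
move: (ch x) (cos t) => C c; rewrite ler_norml; nra.
Qed.

Lemma lpot_xt_bound : `|lpot_xt x t| <= K ^+ 2.
Proof.
apply: div_gap_bound; rewrite normrN normrM.
have := sin_max t; have := ler_sh_ch x; have := ch_ge1 x.
have := normr_ge0 (sin t); have := normr_ge0 (sh x).
move: `|sin t| `|sh x| (ch x) => a S C; nra.
Qed.

Lemma lpot_xxt_bound : `|lpot_xxt x t| <= K ^+ 3.
Proof.
apply: div_gap_bound; rewrite normrM exprS.
apply: ler_pM => //.
  by have := sin_max t; have := ch_ge1 x; lra.
have := cos_geN1 t; have := cos_le1 t; have := ch_ge1 x.
move: (ch x) (cos t) => C c; rewrite ler_norml; nra.
Qed.

End bounds.

(** * Calculus on a segment *)

Section calculus.
Context {R : realType}.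
Notation mu := (@lebesgue_measure R).
Implicit Types (f g F : R -> R) (a b x z t r C : R).

Lemma within_continuous_itv f a b :
  (forall x, a <= x <= b -> {for x, continuous f}) ->
  {within `[a, b], continuous f}.
Proof.
move=> cf; apply: continuous_in_subspaceT => x.
by rewrite inE /= in_itv /= => /cf.
Qed.

Lemma integrable_itv f a b :
  (forall x, a <= x <= b -> {for x, continuous f}) ->
  mu.-integrable `[a, b] (EFin \o f).
Proof.
move=> cf; apply: continuous_compact_integrable; first exact: segment_compact.
exact: within_continuous_itv.
Qed.

Lemma Rintegral_deriv F f a b : a < b ->
  (forall x, a <= x <= b -> has_deriv F x (f x)) ->
  (forall x, a <= x <= b -> {for x, continuous f}) ->
  (\int[mu]_(x in `[a, b]) f x)%R = F b - F a.
Proof.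
move=> ab dF cf; rewrite /Rintegral (@continuous_FTC2 _ f F)//.
- exact: within_continuous_itv.
- split.
  + by move=> x /[!in_itv]/= /andP[ax xb]; apply: (has_deriv_derivable (dF x _)); rewrite !ltW.
  + by apply: cvg_at_right_filter; apply: (has_deriv_cont (dF a _)); rewrite lexx ltW.
  + by apply: cvg_at_left_filter; apply: (has_deriv_cont (dF b _)); rewrite lexx ltW.
- by move=> x /[!in_itv]/= /andP[ax xb]; apply: (has_deriv_val (dF x _)); rewrite !ltW.
Qed.

Lemma deriv_le0_le f df a b : a <= b ->
  (forall x, a <= x <= b -> has_deriv f x (df x)) ->
  (forall x, a <= x <= b -> df x <= 0) -> f b <= f a.
Proof.
move=> ab dF df0.
have [||c cab E] := @MVT_segment _ f df _ _ ab.
- by move=> x; rewrite in_itv /= => /andP[ax xb]; apply: dF; rewrite !ltW.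
- by apply: within_continuous_itv => x /dF; exact: has_deriv_cont.
- rewrite -subr_le0 E mulr_le0_ge0 ?subr_ge0//; apply: df0.
  by move: cab; rewrite in_itv.
Qed.

Lemma le_Rintegral_itv f g a b :
  (forall x, a <= x <= b -> {for x, continuous f}) ->
  (forall x, a <= x <= b -> {for x, continuous g}) ->
  (forall x, a <= x <= b -> f x <= g x) ->
  (\int[mu]_(x in `[a, b]) f x <= \int[mu]_(x in `[a, b]) g x)%R.
Proof.
move=> cf cg fg; apply: le_Rintegral => //.
- exact: (integrable_itv cf).
- exact: (integrable_itv cg).
Qed.

Lemma has_deriv_Rintegral (f df : R -> R -> R) a b x r C : 0 < r ->
  (forall z t, `|z - x| < r -> a <= t <= b -> {for t, continuous (f z)}) ->
  (forall z t, `|z - x| < r -> a <= t <= b -> has_deriv (f^~ t) z (df z t)) ->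
  (forall z t, `|z - x| < r -> a <= t <= b -> `|df z t| <= C) ->
  has_deriv (fun z => \int[mu]_(t in `[a, b]) f z t)%R x
    (\int[mu]_(t in `[a, b]) df x t)%R.
Proof.
move=> r0 cf dF dfC.
have near_x z : [set` `](x - r), (x + r)[] z -> `|z - x| < r.
  by rewrite /= in_itv /= ltr_norml => /andP[? ?]; apply/andP; split; lra.
have xI : [set` `](x - r), (x + r)[] x.
  by rewrite /= in_itv /=; apply/andP; split; lra.
have intf z : [set` `](x - r), (x + r)[] z -> mu.-integrable `[a, b] (EFin \o f z).
  by move=> /near_x zx; apply: integrable_itv => t; exact: cf.
have derf z t : [set` `](x - r), (x + r)[] z -> [set` `[a, b]] t ->
    derivable (f^~ t) z 1.
  move=> /near_x zx; rewrite /= in_itv /= => tab.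
  exact: has_deriv_derivable (dF z t zx tab).
pose G := fun _ : R => `|C|.
have intG : mu.-integrable `[a, b] (EFin \o G).
  by apply: integrable_itv => t _; exact: cst_continuous.
have Gub z t : [set` `](x - r), (x + r)[] z -> [set` `[a, b]] t ->
    `|partial1of2 f z t| <= G t.
  move=> /near_x zx; rewrite /= in_itv /= => tab.
  rewrite /partial1of2 (has_deriv_val (dF z t zx tab)).
  by rewrite (le_trans (dfC z t zx tab))// ler_norm.
have G0 t : 0 <= G t by exact: normr_ge0.
split.
  by apply: (derivable_under_integral _ xI intf derf G0 intG Gub).
rewrite -derive1E (differentiation_under_integral _ xI intf derf G0 intG Gub)//.
apply: eq_Rintegral => t; rewrite inE /= in_itv /= => tab.
by rewrite /partial1of2 (has_deriv_val (dF x t _ tab))// subrr normr0.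
Qed.

End calculus.

(** * Concentration of the kernel at the boundary *)

Section concentration.
Context {R : realType}.
Notation mu := (@lebesgue_measure R).

Lemma deriv_lt0_near (f : R -> R) df : f 0 = 0 -> has_deriv f 0 df -> df < 0 ->
  exists2 r : R, 0 < r & forall t, 0 <= t < r -> f t <= 0.
Proof.
move=> f0 [dvf dE] df0.
have : (fun h => h^-1 *: (f (h *: 1 + 0) - f 0)) @ 0^' --> df by rewrite -dE; exact: dvf.
move=> /cvgrPdist_lt /(_ (- df)); rewrite oppr_gt0 => /(_ df0) [r /= r0 Hr].
exists r => // t /andP[t0 tr].
have [->|tn0] := eqVneq t 0; first by rewrite f0.
have {}t0 : 0 < t by rewrite lt_def tn0.
have := Hr t; rewrite /= sub0r normrN (gtr0_norm t0) => /(_ tr tn0).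
rewrite f0 subr0 addr0 /GRing.scale /= mulr1 => H.
have {H} : t^-1 * f t < 0 by move: H; rewrite ltr_norml => /andP[H1 H2]; lra.
by rewrite pmulr_rlt0 ?invr_gt0// => /ltW.
Qed.

Variable b : R.
Hypothesis b0 : 0 < b.
Let lam : R := pi / b.

Let lam0 : 0 < lam. Proof. by rewrite divr_gt0// pi_gt0. Qed.
Let lamb : lam * b = pi. Proof. by rewrite /lam divfK// gt_eqF. Qed.

Let angle (t : R) : 0 <= t <= b -> 0 <= lam * t <= pi.
Proof.
move=> /andP[t0 tb]; rewrite mulr_ge0//= ?(ltW lam0)// -lamb.
by rewrite ler_wpM2l// ltW.
Qed.

Lemma has_deriv_lam (t : R) : has_deriv (fun z => lam * z) t lam.
Proof. by have := has_derivZ lam (has_deriv_id t); rewrite mulr1. Qed.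

(** The weight [- lpot_xt X (lam * t)] is
    sh X sin (lam t) / (ch X - cos (lam t)) ^+ 2, and its mass against
    1 - cos (lam t) is of order [sh X] times the logarithm of 1 / (ch X - 1).  A
    function [m] with negative slope at 0 lies below
    - (1 - cos) + K (1 - cos)^2 for some [K]; against the weight the first term
    diverges logarithmically, relative to [sh X], while the second stays bounded. *)
Lemma kernel_concentration (m : R -> R) (dm C : R) : m 0 = 0 -> has_deriv m 0 dm ->
  (forall t, 0 <= t <= b -> {for t, continuous m}) ->
  (forall t, 0 <= t <= b -> m t <= C) ->
  (forall X : R, 0 < X ->
    (0 <= \int[mu]_(t in `[0, b]) (m t * - lpot_xt X (lam * t)))%R) ->
  0 <= dm.
Proof.
move=> m0 Dm cm mC Hint; rewrite leNgt; apply/negP => dm0.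
have cos_lam t : {for t, continuous (fun z => cos (lam * z))}.
  exact: has_deriv_cont (has_deriv_comp (has_deriv_lam t) (has_deriv_cos _)).
have D1 : has_deriv (fun t => m t + (1 - cos (lam * t))) 0 dm.
  apply: has_deriv_eq.
    exact: has_derivD Dm (has_derivB (has_deriv_cst 1 0)
      (has_deriv_comp (has_deriv_lam 0) (has_deriv_cos _))).
  by rewrite /= mulr0 sin0; ring.
have [|r r0 Hr] := deriv_lt0_near _ D1 dm0.
  by rewrite m0 mulr0 cos0; ring.
pose tau := Num.min (r / 2) b.
have tau0 : 0 < tau by rewrite lt_min b0 andbT divr_gt0.
have taub : tau <= b by rewrite ge_min lexx orbT.
have taur : tau < r by rewrite gt_min; apply/orP; left; lra.
pose d := 1 - cos (lam * tau).
have angtau : 0 <= lam * tau <= pi by apply: angle; rewrite taub ltW.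
have d0 : 0 < d.
  rewrite subr_gt0 -[X in _ < X](@cos0 R) ltr_cos ?in_itv//= ?lexx ?pi_ge0//.
  by rewrite mulr_gt0.
pose K := (`|C| + 2) / d ^+ 2.
have K0 : 0 <= K by rewrite divr_ge0 ?sqr_ge0// addr_ge0.
(* near 0 the slope wins; away from 0 the quadratic term absorbs [m] *)
have mle t : 0 <= t <= b ->
    m t <= - (1 - cos (lam * t)) + K * (1 - cos (lam * t)) ^+ 2.
  move=> tb; have [tt|tt] := ltP t tau.
    have := Hr t; rewrite (lt_trans tt taur) andbT; case/andP: (tb) => t0 _.
    move=> /(_ t0) H; have : 0 <= K * (1 - cos (lam * t)) ^+ 2.
      by rewrite mulr_ge0 ?sqr_ge0.
    lra.
  have dle : d <= 1 - cos (lam * t).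
    rewrite lerD2l lerN2 leNgt ltr_cos ?in_itv//= ?angle// -leNgt.
    by rewrite ler_pM2l.
  have : K * d ^+ 2 <= K * (1 - cos (lam * t)) ^+ 2.
    by rewrite ler_wpM2l// lerXn2r// nnegrE ?ltW// (lt_le_trans d0).
  rewrite /K divfK ?expf_neq0 ?gt_eqF//.
  have := mC t tb; have := ler_norm C; have := cos_geN1 (lam * t); lra.
(* [X] so small that ln (ch X - 1) <= - (2 + 2 K) beats the quadratic term *)
pose e := expR (- (2 + 2 * K)) : R.
have e0 : 0 < e := expR_gt0 _.
pose X := ln (1 + e).
have X0 : 0 < X by rewrite ln_gt0//; lra.
have chX : ch X <= 1 + e.
  by rewrite (le_trans (ch_le_expR (ltW X0)))// lnK// posrE; lra.
have chX1 := ch_gt1 X0.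
have shX : 0 < sh X.
  by have := ch2Bsh2 X; have := sh_ge0 (ltW X0); move: (ch X) (sh X) chX1 => u v *; nra.
pose g t := sin (lam * t) * (- (1 - cos (lam * t)) / gap X (lam * t) ^+ 2 + K).
pose F t := - (ln (gap X (lam * t)) + (ch X - 1) / gap X (lam * t)) - K * cos (lam * t).
have gp t : 0 < gap X (lam * t) by exact: gap_gt0.
have Dgap t : has_deriv (fun t => gap X (lam * t)) t (lam * sin (lam * t)).
  exact: has_deriv_comp (has_deriv_lam t) (has_deriv_gap_t _ _).
have DF t : has_deriv F t (lam * g t).
  apply: has_deriv_eq.
    exact: (has_derivB
      (has_derivN (has_derivD
        (has_deriv_comp (Dgap t) (has_deriv_ln (gp t)))
        (has_deriv_div (g := fun t => gap X (lam * t)) (lt0r_neq0 (gp t))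
          (has_deriv_cst (ch X - 1) t) (Dgap t))))
      (has_derivZ K (has_deriv_comp (has_deriv_lam t) (has_deriv_cos _)))).
  rewrite /g /=; have := lt0r_neq0 (gp t); rewrite /gap.
  by move: (sin _) (cos _) (ch X) => s c D gn0; field.
have cgap n t : {for t, continuous (fun t => gap X (lam * t) ^+ n)}.
  exact: has_deriv_cont (has_derivX n (Dgap t)).
have gn0 n t : gap X (lam * t) ^+ n != 0 by rewrite expf_neq0 ?lt0r_neq0.
have Dsin t := has_deriv_comp (has_deriv_lam t) (has_deriv_sin _).
have Dcos t := has_deriv_comp (has_deriv_lam t) (has_deriv_cos _).
have cg t : {for t, continuous g}.
  exact: has_deriv_cont (has_derivM (Dsin t) (has_derivD
    (has_deriv_div (g := fun t => gap X (lam * t) ^+ 2) (gn0 2%N t)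
      (has_derivN (has_derivB (has_deriv_cst 1 t) (Dcos t)))
      (has_derivX 2 (Dgap t)))
    (has_deriv_cst K t))).
have := Hint X X0; apply/negP; rewrite -ltNge.
apply: (@le_lt_trans _ _ (\int[mu]_(t in `[0, b]) (sh X / lam * (lam * g t)))).
  apply: le_Rintegral_itv => t tb.
  - apply: (@continuousM _ _ m); first exact: cm.
    apply: continuousN.
    exact: (has_deriv_cont (has_deriv_div (g := fun t => gap X (lam * t) ^+ 2)
      (gn0 2%N t) (has_derivN (has_derivM (Dsin t) (has_deriv_cst (sh X) t)))
      (has_derivX 2 (Dgap t)))).
  - apply: continuousM; first exact: cst_continuous.
    by apply: continuousM; [exact: cst_continuous|exact: cg].
  - have s0 : 0 <= sin (lam * t) by rewrite sin_ge0_pi// angle.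
    rewrite mulrA divfK ?gt_eqF// /lpot_xt mulNr opprK.
    have -> : sh X * g t = (- (1 - cos (lam * t)) + K * gap X (lam * t) ^+ 2) *
         (sin (lam * t) * sh X / gap X (lam * t) ^+ 2).
      by rewrite /g; field; exact: lt0r_neq0.
    rewrite ler_wpM2r//.
      by rewrite divr_ge0 ?sqr_ge0// mulr_ge0// ltW.
    rewrite (le_trans (mle t tb))// lerD2l ler_wpM2l// lerXn2r ?nnegrE ?(ltW (gp t))//.
    by rewrite lerD2r ltW.
have := @Rintegral_deriv R (fun t => sh X / lam * F t)
  (fun t => sh X / lam * (lam * g t)) 0 b b0.
move=> ->.
- rewrite -mulrBr pmulr_rlt0; last exact: divr_gt0 shX lam0.
  suff : F b < F 0 by move: (F b) (F 0) => u v; lra.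
  rewrite /F lamb cospi mulr0 cos0 /gap cospi cos0.
  have L1 : ln (ch X - 1) <= - (2 + 2 * K).
    by rewrite -[leRHS]expRK ler_ln ?posrE ?expR_gt0//; rewrite -/e; lra.
  have L2 : 0 <= ln (ch X - -1) by rewrite ln_ge0; lra.
  have L3 : 0 <= (ch X - 1) / (ch X - -1) by rewrite divr_ge0; lra.
  have L4 : (ch X - 1) / (ch X - 1) = 1 by rewrite divff// subr_eq0 gt_eqF.
  rewrite L4; lra.
- by move=> t _; exact: has_derivZ.
- move=> t _; apply: continuousM; first exact: cst_continuous.
  by apply: continuousM; [exact: cst_continuous|exact: cg].
Qed.

End concentration.

(** * Harmonic functions on a strip and their flux *)

Section strip_harmonic.
Context {R : realType}.

(** [q] is harmonic on 0 <= t <= b, with [qx], [qt] and [qxx] its partial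
    derivatives: harmonicity is the equation q_tt = - q_xx in [strip_dtt].  The
    bounds are global, so that fluxes against a decaying kernel vanish at infinity. *)
Record strip_harmonic (b : R) (q qx qt qxx : R -> R -> R) : Prop := {
  strip_dx : forall x t, 0 <= t <= b -> has_deriv (q^~ t) x (qx x t);
  strip_dxx : forall x t, 0 <= t <= b -> has_deriv (qx^~ t) x (qxx x t);
  strip_dt : forall x t, 0 <= t <= b -> has_deriv (q x) t (qt x t);
  strip_dtt : forall x t, 0 <= t <= b -> has_deriv (qt x) t (- qxx x t);
  strip_cont_x : forall x t, 0 <= t <= b -> {for t, continuous (qx x)};
  strip_cont_xx : forall x t, 0 <= t <= b -> {for t, continuous (qxx x)};
  strip_bound : exists C, forall x t, 0 <= t <= b ->
    [/\ `|qx x t| <= C, `|qt x t| <= C & `|qxx x t| <= C] }.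

Lemma strip_harmonic0 b : strip_harmonic b (fun _ _ => 0) (fun _ _ => 0)
  (fun _ _ => 0) (fun _ _ => 0).
Proof.
split; try by move=> *; exact: cst_continuous.
1-3: by move=> *; exact: has_deriv_cst.
  by move=> *; rewrite oppr0; exact: has_deriv_cst.
by exists 0 => *; rewrite normr0.
Qed.

Lemma strip_harmonicD b q qx qt qxx p px pt pxx :
  strip_harmonic b q qx qt qxx -> strip_harmonic b p px pt pxx ->
  strip_harmonic b (fun x t => q x t + p x t) (fun x t => qx x t + px x t)
    (fun x t => qt x t + pt x t) (fun x t => qxx x t + pxx x t).
Proof.
move=> [q1 q2 q3 q4 q5 q6 [C qC]] [p1 p2 p3 p4 p5 p6 [D pD]]; split.
- by move=> x t tb; exact: (has_derivD (q1 x t tb) (p1 x t tb)).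
- by move=> x t tb; exact: (has_derivD (q2 x t tb) (p2 x t tb)).
- by move=> x t tb; exact: (has_derivD (q3 x t tb) (p3 x t tb)).
- by move=> x t tb; rewrite opprD; exact: (has_derivD (q4 x t tb) (p4 x t tb)).
- by move=> x t tb; exact: (continuousD (q5 x t tb) (p5 x t tb)).
- by move=> x t tb; exact: (continuousD (q6 x t tb) (p6 x t tb)).
- exists (C + D) => x t tb; have [? ? ?] := qC x t tb; have [? ? ?] := pD x t tb.
  by split; rewrite (le_trans (ler_normD _ _))// lerD.
Qed.

Lemma strip_harmonic_sum (I : Type) (s : seq I) b
    (q qx qt qxx : I -> R -> R -> R) (P : I -> Prop) :
  (forall i, P i -> strip_harmonic b (q i) (qx i) (qt i) (qxx i)) ->
  List.Forall P s ->
  strip_harmonic b (fun x t => \sum_(i <- s) q i x t)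
    (fun x t => \sum_(i <- s) qx i x t) (fun x t => \sum_(i <- s) qt i x t)
    (fun x t => \sum_(i <- s) qxx i x t).
Proof.
move=> H; elim: s => [_|i s IH /List.Forall_cons_iff [Pi /IH Hs]].
  have := strip_harmonic0 b; congr strip_harmonic;
  by do 2 apply/funext => ?; rewrite big_nil.
have := strip_harmonicD (H i Pi) Hs; congr strip_harmonic;
by do 2 apply/funext => ?; rewrite big_cons.
Qed.

Lemma strip_harmonic_reflect b q qx qt qxx : strip_harmonic b q qx qt qxx ->
  strip_harmonic b (fun x t => q (- x) t) (fun x t => - qx (- x) t)
    (fun x t => qt (- x) t) (fun x t => qxx (- x) t).
Proof.
have DN x : has_deriv (fun z : R => - z) x (- 1) by exact: has_derivN (has_deriv_id x).
move=> [q1 q2 q3 q4 q5 q6 [C qC]]; split.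
- move=> x t tb; apply: has_deriv_eq.
    exact: has_deriv_comp (DN x) (q1 (- x) t tb).
  by rewrite mulN1r.
- move=> x t tb; apply: has_deriv_eq.
    exact: has_derivN (has_deriv_comp (DN x) (q2 (- x) t tb)).
  by rewrite mulN1r opprK.
- by move=> x t tb; exact: q3.
- by move=> x t tb; exact: q4.
- by move=> x t tb; apply: continuousN; exact: q5.
- by move=> x t tb; exact: q6.
- by exists C => x t tb; rewrite normrN; exact: qC.
Qed.

End strip_harmonic.

Section strip.
Context {R : realType}.
Notation mu := (@lebesgue_measure R).

Variables (b : R) (q qx qt qxx : R -> R -> R).
Hypothesis b0 : 0 < b.
Hypothesis qH : strip_harmonic b q qx qt qxx.
Hypothesis q_0 : forall x, q x 0 = 0.

Let lam : R := pi / b.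
Let lam0 : 0 < lam. Proof. by rewrite divr_gt0// pi_gt0. Qed.
Let lamb : lam * b = pi. Proof. by rewrite /lam divfK// gt_eqF. Qed.

Let C : R := projT1 (cid (strip_bound qH)).
Let CP (x t : R) : 0 <= t <= b -> [/\ `|qx x t| <= C, `|qt x t| <= C & `|qxx x t| <= C].
Proof. exact: (projT2 (cid (strip_bound qH))). Qed.

Let tb0 : 0 <= (0 : R) <= b. Proof. by rewrite lexx ltW. Qed.

Let C0 : 0 <= C.
Proof. by have [H _ _] := CP 0 tb0; exact: le_trans H. Qed.

(** The mean value theorem in [t], from the line t = 0. *)
Lemma strip_value_bound : exists D, forall x t, 0 <= t <= b -> `|q x t| <= D.
Proof.
exists (C * b) => x t /andP[t0 tb].
have tt s : 0 <= s <= t -> 0 <= s <= b.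
  by case/andP => s0 st; rewrite s0 (le_trans st).
have D s : 0 <= s <= t -> has_deriv (fun s => C * s) s C.
  by move=> _; have := has_derivZ C (has_deriv_id s); rewrite mulr1.
have H1 : q x t - C * t <= q x 0 - C * 0.
  apply: (deriv_le0_le (f := fun s => q x s - C * s) (df := fun s => qt x s - C) t0).
    by move=> s st; exact: has_derivB (strip_dt qH x (tt s st)) (D s st).
  move=> s st; have [_ H _] := CP x (tt s st).
  by rewrite subr_le0 (le_trans (ler_norm _)).
have H2 : - q x t - C * t <= - q x 0 - C * 0.
  apply: (deriv_le0_le (f := fun s => - q x s - C * s) (df := fun s => - qt x s - C) t0).
    by move=> s st; exact: has_derivB (has_derivN (strip_dt qH x (tt s st))) (D s st).
  move=> s st; have [_ H _] := CP x (tt s st).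
  by rewrite subr_le0 (le_trans (ler_norm _))// normrN.
have H3 : C * t <= C * b by rewrite ler_wpM2l.
by move: H1 H2; rewrite q_0 ler_norml => *; apply/andP; split; lra.
Qed.

Let M : R := projT1 (cid strip_value_bound).
Let q_bound (x t : R) : 0 <= t <= b -> `|q x t| <= M.
Proof. exact: (projT2 (cid strip_value_bound)). Qed.
Let M0 : 0 <= M. Proof. exact: le_trans (q_bound 0 tb0). Qed.

Variables (eta : R) (sg c : R).
Hypothesis eta0 : 0 < eta.
Hypothesis sg2 : sg ^+ 2 = 1.

(** The kernel is lpot_t(lam (|x - c| + eta), lam t), harmonic on either side of
    x = c and zero at t = 0 and t = b; [sg] is 1 to the right of [c] and -1 to the
    left, where sg (x - c) = |x - c|. *)
Definition kernel_arg x := lam * (sg * (x - c) + eta).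
Let X := kernel_arg.

Definition flux x := (\int[mu]_(t in `[0, b])
  (qx x t * lpot_t (kernel_arg x) (lam * t)
     - q x t * (sg * lam * lpot_xt (kernel_arg x) (lam * t))))%R.

Let DX x : has_deriv X x (sg * lam).
Proof.
have H := has_derivZ lam (has_derivD (has_derivZ sg
  (has_derivB (has_deriv_id x) (has_deriv_cst c x))) (has_deriv_cst eta x)).
by apply: (has_deriv_eq H); ring.
Qed.

Let Dlam (t : R) : has_deriv (fun z => lam * z) t lam.
Proof. exact: has_deriv_lam. Qed.

Let cont_lam (f : R -> R) t : {for lam * t, continuous f} ->
  {for t, continuous (fun z => f (lam * z))}.
Proof.
move=> cf; apply: (continuous_comp (f := fun z => lam * z)) => //.
exact: has_deriv_cont (Dlam t).
Qed.

Lemma flux_cont x t : 0 < X x -> 0 <= t <= b ->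
  {for t, continuous (fun t => qx x t * lpot_t (X x) (lam * t)
     - q x t * (sg * lam * lpot_xt (X x) (lam * t)))}.
Proof.
move=> X0 tb; have g0 := gap_gt0 (lam * t) X0.
apply: continuousB; apply: continuousM.
- exact: (strip_cont_x qH).
- by apply: cont_lam; exact: has_deriv_cont (lpot_t_derive_t g0).
- exact: has_deriv_cont (strip_dt qH x tb).
- apply: continuousM; first exact: cst_continuous.
  by apply: cont_lam; exact: lpot_xt_cont_t.
Qed.

(** Green's formula on a vertical segment: since [q] and the kernel are both
    harmonic the derivative of the integrand in [x] is a derivative in [t], and
    among the boundary terms only the one carrying [q x b] survives. *)
Lemma flux_deriv x : 0 < X x ->
  has_deriv flux x (- (lam * q x b / (1 + ch (X x)))).
Proof.
move=> X0.
pose df z t := qxx z t * lpot_t (X z) (lam * t)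
     - q z t * (lam ^+ 2 * lpot_xxt (X z) (lam * t)).
pose r := X x / (2 * lam).
have r0 : 0 < r by rewrite divr_gt0// mulr_gt0.
have Xr z : `|z - x| < r -> X x / 2 <= X z.
  move=> zx.
  have -> : X z = X x + lam * (sg * (z - x)) by rewrite /X /kernel_arg; ring.
  have : lam * `|sg * (z - x)| <= X x / 2.
    have -> : X x / 2 = lam * r by rewrite /r; field; rewrite gt_eqF.
    rewrite ler_wpM2l ?(ltW lam0)// normrM.
    have -> : `|sg| = 1.
      by apply/eqP; rewrite -sqrp_eq1// -normrX sg2 normr1.
    by rewrite mul1r ltW.
  have : lam * - `|sg * (z - x)| <= lam * (sg * (z - x)).
    by rewrite ler_wpM2l ?(ltW lam0)// lerNl -normrN ler_norm.
  rewrite mulrN; move: (lam * (sg * (z - x))) (lam * `|_|) (X x) => u v w; lra.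
have X2 : 0 < X x / 2 by rewrite divr_gt0.
have Xz z : `|z - x| < r -> 0 < X z by move/Xr; exact: lt_le_trans.
have dfE : (\int[mu]_(t in `[0, b]) df x t)%R = - (lam * q x b / (1 + ch (X x))).
  pose F t := q x t * (lam * - lpot_xx (X x) (lam * t)) - qt x t * lpot_t (X x) (lam * t).
  have := @Rintegral_deriv R F (df x) 0 b b0; move=> ->.
  - rewrite /F mulr0 lamb q_0 mul0r /lpot_t sin0 sinpi !mul0r !mulr0 !subr0.
    rewrite /lpot_xx /gap cospi mulrN1 !opprK (addrC (ch _)).
    have : 1 + ch (X x) != 0 by rewrite gt_eqF//; have := ch_ge1 (X x); lra.
    by move: (ch _) => D D0; field.
  - move=> t tb; have g0 := gap_gt0 (lam * t) X0.
    apply: has_deriv_eq.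
      exact: has_derivB (has_derivM (strip_dt qH x tb) (has_derivZ lam
        (has_derivN (has_deriv_comp (Dlam t) (lpot_xx_derive_t g0)))))
        (has_derivM (strip_dtt qH x tb)
          (has_deriv_comp (Dlam t) (lpot_t_derive_t g0))).
    by rewrite /df /=; ring.
  - move=> t tb; have g0 := gap_gt0 (lam * t) X0.
    apply: continuousB; apply: continuousM.
    + exact: (strip_cont_xx qH).
    + by apply: cont_lam; exact: has_deriv_cont (lpot_t_derive_t g0).
    + exact: has_deriv_cont (strip_dt qH x tb).
    + apply: continuousM; first exact: cst_continuous.
      by apply: cont_lam; exact: lpot_xxt_cont_t.
rewrite -dfE.
pose m := ch (X x / 2) - 1.
have m0 : 0 < m by rewrite subr_gt0 ch_gt1.
pose K := 1 + 2 / m.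
apply: (@has_deriv_Rintegral _ _ df 0 b x r (C * K + M * (lam ^+ 2 * K ^+ 3))) => //.
- by move=> z t zx tb; exact: flux_cont (Xz z zx) tb.
- move=> z t zx tb; have g0 := gap_gt0 (lam * t) (Xz z zx).
  apply: has_deriv_eq.
    exact: has_derivB (has_derivM (strip_dxx qH z tb)
      (has_deriv_comp (DX z) (lpot_t_derive_x g0)))
      (has_derivM (strip_dx qH z tb) (has_derivZ (sg * lam)
         (has_deriv_comp (DX z) (lpot_xt_derive_x g0)))).
  rewrite /df /=.
  have -> : lam ^+ 2 = sg ^+ 2 * lam ^+ 2 by rewrite sg2 mul1r.
  by rewrite -/X; ring.
- move=> z t zx tb.
  have mg : m <= gap (X z) (lam * t).
    rewrite /m /gap; have := cos_le1 (lam * t).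
    have : ch (X x / 2) <= ch (X z) by apply: le_ch; rewrite (ltW X2)/= Xr.
    lra.
  have [_ _ Cqxx] := CP z tb.
  rewrite /df (le_trans (ler_normB _ _))// lerD// normrM ler_pM//.
  + exact: lpot_t_bound.
  + exact: q_bound.
  + rewrite normrM (ger0_norm (sqr_ge0 _)) ler_wpM2l ?sqr_ge0//.
    exact: lpot_xxt_bound.
Qed.

(** The kernel decays like the inverse of [ch] of its argument, while [q] and [qx]
    stay bounded. *)
Lemma flux_cvg0 (e : R) : 0 < e ->
  exists A, forall x, A <= sg * (x - c) -> `|flux x| <= e.
Proof.
move=> e0.
pose B := 2 * C + M * (4 * lam).
have B0 : 0 <= B.
  by apply: addr_ge0; apply: mulr_ge0 => //; rewrite mulr_ge0// ltW.
pose E := 4 + b * B / e.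
have bBe : 0 <= b * B / e by apply: divr_ge0; [apply: mulr_ge0 => //|]; exact: ltW.
have E4 : 4 <= E by rewrite lerDl.
exists (2 * E / lam) => x xA.
have XE : 2 * E <= X x.
  rewrite /X /kernel_arg [leRHS]mulrDr.
  have h : 2 * E <= lam * (sg * (x - c)).
    by rewrite (mulrC lam) -ler_pdivrMr.
  by rewrite (le_trans h)// lerDl mulr_ge0// ltW.
have X0 : 0 < X x by apply: lt_le_trans XE; lra.
have chE : E <= ch (X x).
  by have := ch_ge_half (ltW X0); move: XE; move: (ch (X x)) (X x) => u v *; lra.
have ch4 : 4 <= ch (X x) by exact: le_trans chE.
have ch0 : 0 < ch (X x) by apply: lt_le_trans ch4.
have gE t : ch (X x) / 2 <= gap (X x) t.
  by rewrite /gap; have := cos_le1 t; move: (cos t) (ch (X x)) ch4 => u v; lra.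
have intb t : 0 <= t <= b -> `|qx x t * lpot_t (X x) (lam * t)
     - q x t * (sg * lam * lpot_xt (X x) (lam * t))| <= B / ch (X x).
  move=> tb; have [Cqx _ _] := CP x tb.
  have g0 := gap_gt0 (lam * t) X0.
  have gi : (gap (X x) (lam * t))^-1 <= 2 / ch (X x).
    by rewrite -[2 / _]invf_div lef_pV2 ?posrE// divr_gt0.
  have gi0 : 0 <= (gap (X x) (lam * t))^-1 by rewrite invr_ge0 ltW.
  have L1 : `|lpot_t (X x) (lam * t)| <= 2 / ch (X x).
    rewrite normrM normfV (gtr0_norm g0) -[leRHS]mul1r ler_pM//.
    exact: sin_max.
  have L2 : `|lpot_xt (X x) (lam * t)| <= 4 / ch (X x).
    have -> : 4 / ch (X x) = (1 * ch (X x)) * (2 / ch (X x)) ^+ 2.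
      by field; rewrite gt_eqF.
    rewrite /lpot_xt normrM normrN normrM normfV normrX (gtr0_norm g0) -exprVn.
    rewrite ler_pM ?mulr_ge0 ?exprn_ge0//.
      by rewrite ler_pM// ?sin_max// ler_sh_ch.
    by rewrite lerXn2r// nnegrE (le_trans gi0).
  have s1 : `|sg| = 1 by apply/eqP; rewrite -sqrp_eq1// -normrX sg2 normr1.
  have -> : B / ch (X x) = C * (2 / ch (X x)) + M * (lam * (4 / ch (X x))).
    by rewrite /B; field; rewrite gt_eqF.
  rewrite (le_trans (ler_normB _ _))// lerD// normrM ler_pM//; first exact: q_bound.
  by rewrite normrM normrM s1 mul1r (gtr0_norm lam0) ler_wpM2l// ltW.
have cf t (tb : 0 <= t <= b) := @flux_cont x t X0 tb.
have BI : (\int[mu]_(t in `[0, b]) (B / ch (X x)))%R = B / ch (X x) * b.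
  have := @Rintegral_deriv R (fun t => B / ch (X x) * t) (fun=> B / ch (X x)) 0 b b0.
  move=> ->; first by rewrite mulr0 subr0.
  - by move=> t _; have := has_derivZ (B / ch (X x)) (has_deriv_id t); rewrite mulr1.
  - by move=> t _; exact: cst_continuous.
rewrite /flux (le_trans (le_normr_Rintegral _ _))//; first exact: (integrable_itv cf).
apply: (@le_trans _ _ (\int[mu]_(t in `[0, b]) (B / ch (X x)))%R).
  apply: le_Rintegral_itv => [t tb|t tb|t tb]; last exact: intb.
  - apply: continuous_comp; first exact: cf.
    exact: norm_continuous.
  - exact: cst_continuous.
rewrite BI mulrAC ler_pdivrMr// -ler_pdivrMl// (le_trans _ chE)//.
by rewrite (_ : e^-1 * (B * b) = b * B / e) ?lerDr ?ler0n//; ring.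
Qed.

End strip.

(** * Harnack inequality for the normal derivative *)

Section harnack.
Context {R : realType}.
Notation mu := (@lebesgue_measure R).

Lemma nonincr_cvg0_ge0 (g dg : R -> R) (x0 : R) :
  (forall x, x0 <= x -> has_deriv g x (dg x)) ->
  (forall x, x0 <= x -> dg x <= 0) ->
  (forall e, 0 < e -> exists A, forall x, A <= x -> `|g x| <= e) ->
  0 <= g x0.
Proof.
move=> Dg dg0 g0; rewrite leNgt; apply/negP => gx0.
have [|A HA] := g0 (- g x0 / 2); first by rewrite divr_gt0// oppr_gt0.
pose y := Num.max A x0.
have yx : x0 <= y by rewrite le_max lexx orbT.
have yA : A <= y by rewrite le_max lexx.
have H : g y <= g x0.
  apply: (deriv_le0_le yx) => z /andP[xz _]; [exact: Dg|exact: dg0].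
by have := HA y yA; rewrite ler_norml => /andP[H1 H2]; lra.
Qed.

Section kernel_average.
Variables (b : R) (q qx qt qxx : R -> R -> R).
Hypothesis b0 : 0 < b.
Hypothesis qH : strip_harmonic b q qx qt qxx.
Hypothesis q_0 : forall x, q x 0 = 0.
Hypothesis q_b : forall x, 0 <= q x b.

Let lam : R := pi / b.
Let lam0 : 0 < lam. Proof. by rewrite divr_gt0// pi_gt0. Qed.

Variable eta : R.
Hypothesis eta0 : 0 < eta.

(** The mean of q(c, .) against the jump in slope of the kernel across x = c. *)
Definition kernel_average c :=
  (\int[mu]_(t in `[0, b]) (q c t * - lpot_xt (lam * eta) (lam * t)))%R.

Let fl := flux b q qx eta.
Let ar := kernel_arg b eta.

Let leta : 0 < lam * eta. Proof. exact: mulr_gt0. Qed.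

Let arE sg c : ar sg c c = lam * eta.
Proof. by rewrite /ar /kernel_arg subrr mulr0 add0r. Qed.

Let sg1 : (1 : R) ^+ 2 = 1. Proof. by rewrite expr1n. Qed.
Let sgN1 : (-1 : R) ^+ 2 = 1. Proof. by rewrite sqrrN expr1n. Qed.

Let ar_gt0 (sg c x : R) : 0 <= sg * (x - c) -> 0 < ar sg c x.
Proof. by move=> h; rewrite mulr_gt0// ltr_wpDl. Qed.

(** The two one-sided fluxes see the same kernel but with opposite slopes in
    [x], so their difference keeps only the values of [q] on the segment. *)
Lemma flux_jump c : fl 1 c c - fl (-1) c c = 2 * lam * kernel_average c.
Proof.
have X1 : 0 < kernel_arg b eta 1 c c by rewrite [X in 0 < X]arE.
have X2 : 0 < kernel_arg b eta (-1) c c by rewrite [X in 0 < X]arE.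
have c1 t (tb : 0 <= t <= b) := flux_cont qH X1 tb.
have c2 t (tb : 0 <= t <= b) := flux_cont qH X2 tb.
have c3 t : 0 <= t <= b ->
    {for t, continuous (fun t => q c t * - lpot_xt (lam * eta) (lam * t))}.
  move=> tb; apply: continuousM; first exact: has_deriv_cont (strip_dt qH c tb).
  apply: continuousN; apply: (continuous_comp (f := fun z => lam * z)).
    exact: has_deriv_cont (has_deriv_lam b t).
  by apply: lpot_xt_cont_t; exact: gap_gt0.
rewrite /fl /flux -RintegralB//; [|exact: (integrable_itv c1)|exact: (integrable_itv c2)].
rewrite /kernel_average -RintegralZl//; last exact: (integrable_itv c3).
apply: eq_Rintegral => t _.
by rewrite -/(ar 1 c c) -/(ar (-1) c c) !arE -/lam; ring.
Qed.

(** The boundary values of the kernel are multiples of 1 / (1 + ch u): their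
    logarithm is 1-Lipschitz in [u]. *)
Lemma one_ch_shift_le (u v h : R) : 0 <= u <= v + h -> 0 <= h ->
  (1 + ch v)^-1 <= expR h / (1 + ch u).
Proof.
move=> uv h0; have v1 := ch_ge1 v; have u1 := ch_ge1 u.
rewrite ler_pdivlMr; last by lra.
rewrite mulrC ler_pdivrMr; last by lra.
have := le_ch uv; have := ch_shift_le v h0; have : 1 <= expR h.
  by rewrite -expR0 ler_expR.
by move: (ch (v + h)) (ch u) (ch v) (expR h) v1 u1 => a c d e *; nra.
Qed.

Let comb E sg c sg' s x := E * fl sg c x - fl sg' s x.

Let comb_deriv (E sg c sg' s x : R) : sg ^+ 2 = 1 -> sg' ^+ 2 = 1 ->
  0 <= sg * (x - c) -> 0 <= sg' * (x - s) ->
  has_deriv (comb E sg c sg' s) x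
    (- (lam * q x b * (E / (1 + ch (ar sg c x)) - (1 + ch (ar sg' s x))^-1))).
Proof.
move=> s1 s2 h1 h2.
have H1 := flux_deriv b0 qH q_0 s1 (ar_gt0 h1).
have H2 := flux_deriv b0 qH q_0 s2 (ar_gt0 h2).
apply: (has_deriv_eq (has_derivB (has_derivZ E H1) H2)).
rewrite -/(ar sg c x) -/(ar sg' s x) -/lam; ring.
Qed.

Let comb_deriv_le0 (E sg c sg' s x : R) : 0 <= sg * (x - c) ->
  sg * (x - c) <= sg' * (x - s) + E -> 0 <= E ->
  - (lam * q x b * (expR (lam * E) / (1 + ch (ar sg c x)) - (1 + ch (ar sg' s x))^-1)) <= 0.
Proof.
move=> h1 h2 E0; rewrite oppr_le0 mulr_ge0//; first by rewrite mulr_ge0// ltW.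
rewrite subr_ge0 one_ch_shift_le//; last by rewrite mulr_ge0// ltW.
rewrite ltW ?ar_gt0//= /ar /kernel_arg -mulrDr ler_wpM2l ?(ltW lam0)//.
lra.
Qed.

Let comb_cvg0 (E sg c sg' s : R) : sg ^+ 2 = 1 -> sg' ^+ 2 = 1 ->
  forall e, 0 < e -> exists A, forall x, A <= sg * (x - c) -> A <= sg' * (x - s) ->
    `|comb E sg c sg' s x| <= e.
Proof.
move=> s1 s2 e e0.
have d0 : 0 < e / (2 * (1 + `|E|)) by rewrite divr_gt0// mulr_gt0// ltr_wpDr.
have [A1 H1] := flux_cvg0 b0 qH q_0 c eta0 s1 d0.
have e2 : 0 < e / 2 by rewrite divr_gt0.
have [A2 H2] := flux_cvg0 b0 qH q_0 s eta0 s2 e2.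
exists (Num.max A1 A2) => x; rewrite !ge_max => /andP[x1 _] /andP[_ x2].
rewrite /comb (le_trans (ler_normB _ _))// [leRHS](splitr e) lerD//; last exact: H2.
rewrite normrM (le_trans (ler_wpM2l _ (H1 x x1)))//.
have E1 : 0 < 1 + `|E| by rewrite ltr_wpDr.
have -> : `|E| * (e / (2 * (1 + `|E|))) = e / 2 * (`|E| / (1 + `|E|)).
  by field; rewrite gt_eqF.
by rewrite ler_piMr ?(ltW e2)// ler_pdivrMr// mul1r lerDr.
Qed.

(** The flux decreases in [x] because [q_b] makes its derivative nonpositive; since
    it vanishes at both ends, it is nonnegative to the right of [c] and nonpositive
    to the left, and its jump at [c] is nonnegative. *)
Lemma kernel_average_ge0 c : 0 <= kernel_average c.
Proof.
have lt2 : 0 < 2 * lam by rewrite mulr_gt0.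
rewrite -(pmulr_rge0 _ lt2) -flux_jump.
have H1 : 0 <= fl 1 c c.
  apply: (@nonincr_cvg0_ge0 (fl 1 c) (fun x => - (lam * q x b / (1 + ch (ar 1 c x))))).
  - by move=> x cx; apply: (flux_deriv b0 qH) => //; apply: ar_gt0; rewrite mul1r subr_ge0.
  - move=> x _; rewrite oppr_le0; apply: divr_ge0; first by rewrite mulr_ge0// ltW.
    by rewrite addr_ge0// (le_trans ler01)// ch_ge1.
  - move=> e e0; have [A HA] := flux_cvg0 b0 qH q_0 c eta0 sg1 e0.
    by exists (A + c) => x; rewrite -lerBrDr -[x - c]mul1r; exact: HA.
have H2 : 0 <= - fl (-1) c (- - c).
  apply: (@nonincr_cvg0_ge0 (fun x => - fl (-1) c (- x))
      (fun x => - (lam * q (- x) b / (1 + ch (ar (-1) c (- x)))))).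
  - move=> x cx; have x0 : 0 < ar (-1) c (- x).
      by apply: ar_gt0; rewrite mulN1r opprB subr_ge0 lerNl.
    have D := flux_deriv b0 qH q_0 sgN1 x0.
    apply: (has_deriv_eq (has_derivN (has_deriv_comp (has_derivN (has_deriv_id x)) D))).
    by rewrite mulN1r opprK.
  - move=> x _; rewrite oppr_le0; apply: divr_ge0; first by rewrite mulr_ge0// ltW.
    by rewrite addr_ge0// (le_trans ler01)// ch_ge1.
  - move=> e e0; have [A HA] := flux_cvg0 b0 qH q_0 c eta0 sgN1 e0.
    exists (A - c) => x xA; rewrite normrN; apply: HA.
    by rewrite mulN1r; lra.
by move: H2; rewrite opprK oppr_ge0 => H2; rewrite subr_ge0 (le_trans H2).
Qed.

(** Combine the kernels at [c] and [s], the former with weight e^(lam (s - c)).  The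
    combined kernel is nonnegative on the line t = b by [one_ch_shift_le], so the
    combined flux decreases on each of the three intervals cut out by [c] and [s]
    and vanishes at both ends; hence the jump at [c] dominates the one at [s]. *)
Lemma kernel_average_harnack c s : c <= s ->
  kernel_average s <= expR (lam * (s - c)) * kernel_average c.
Proof.
move=> cs.
have negc x : - c <= x -> 0 <= -1 * (- x - c) by move=> ?; lra.
have negs x : - c <= x -> 0 <= -1 * (- x - s) by move=> ?; lra.
have shift x : -1 * (- x - c) <= -1 * (- x - s) + (s - c) by lra.
set h := s - c; have h0 : 0 <= h by rewrite subr_ge0.
set E := expR (lam * h).
have lt2 : 0 < 2 * lam by rewrite mulr_gt0.
rewrite -(ler_pM2l lt2) [leRHS]mulrCA -!flux_jump.
have right : 0 <= comb E 1 c 1 s s.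
  apply: (@nonincr_cvg0_ge0 (comb E 1 c 1 s) _ s).
  - by move=> x sx; apply: comb_deriv => //; rewrite mul1r; lra.
  - by move=> x sx; apply: comb_deriv_le0; rewrite /h ?mul1r; lra.
  - move=> e e0; have [A HA] := comb_cvg0 E c s sg1 sg1 e0.
    by exists (Num.max (A + c) (A + s)) => x; rewrite ge_max => /andP[? ?]; apply: HA; lra.
have middle : comb E 1 c (-1) s s <= comb E 1 c (-1) s c.
  apply: (deriv_le0_le cs) => x /andP[cx xs].
  - by apply: comb_deriv => //; lra.
  - by apply: comb_deriv_le0; rewrite /h; lra.
have left : 0 <= - comb E (-1) c (-1) s (- - c).
  apply: (@nonincr_cvg0_ge0 (fun x => - comb E (-1) c (-1) s (- x))
    (fun x => - (lam * q (- x) b * (E / (1 + ch (ar (-1) c (- x)))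
       - (1 + ch (ar (-1) s (- x)))^-1))) (- c)).
  - move=> x cx; have D := comb_deriv E sgN1 sgN1 (negc x cx) (negs x cx).
    apply: (has_deriv_eq (has_derivN (has_deriv_comp (has_derivN (has_deriv_id x)) D))).
    by rewrite mulN1r opprK.
  - by move=> x cx; apply: comb_deriv_le0 => //; exact: negc.
  - move=> e e0; have [A HA] := comb_cvg0 E c s sgN1 sgN1 e0.
    exists (Num.max (A - c) (A - s)) => x; rewrite ge_max => /andP[xc xs].
    by rewrite normrN; apply: HA; rewrite mulN1r opprB opprK -lerBlDl.
move: right middle left; rewrite opprK /comb.
move: (fl 1 c s) (fl 1 c c) (fl (-1) c c) (fl 1 s s) (fl (-1) s s) (fl (-1) s c).
by move=> f1 f2 f3 f4 f5 f6; rewrite mulrBr; lra.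
Qed.

End kernel_average.

Section normal_derivative.
Variables (b : R) (q qx qt qxx : R -> R -> R).
Hypothesis b0 : 0 < b.
Hypothesis qH : strip_harmonic b q qx qt qxx.
Hypothesis q_0 : forall x, q x 0 = 0.
Hypothesis q_b : forall x, 0 <= q x b.

Let lam : R := pi / b.
Let lam0 : 0 < lam. Proof. by rewrite divr_gt0// pi_gt0. Qed.

Lemma normal_deriv_comb_ge0 (A B c s : R) :
  (forall eta : R, 0 < eta -> 0 <= A * kernel_average b q eta c - B * kernel_average b q eta s) ->
  0 <= A * qt c 0 - B * qt s 0.
Proof.
move=> H; have tb0 : 0 <= (0 : R) <= b by rewrite lexx ltW.
have [D HD] := strip_value_bound b0 qH q_0.
have cq x t (tb : 0 <= t <= b) := has_deriv_cont (strip_dt qH x tb).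
have cm t : 0 <= t <= b -> {for t, continuous (fun t => A * q c t - B * q s t)}.
  by move=> tb; apply: continuousB; apply: continuousM;
    [exact: cst_continuous|exact: cq|exact: cst_continuous|exact: cq].
apply: (@kernel_concentration R b b0 (fun t => A * q c t - B * q s t) _ (`|A| * D + `|B| * D)).
- by rewrite !q_0; ring.
- exact: has_derivB (has_derivZ A (strip_dt qH c tb0)) (has_derivZ B (strip_dt qH s tb0)).
- exact: cm.
- move=> t tb; rewrite (le_trans (ler_norm _))// (le_trans (ler_normB _ _))//.
  by rewrite !normrM lerD// ler_wpM2l// HD.
- move=> X X0; have := H (X / lam) (divr_gt0 X0 lam0).
  rewrite /kernel_average -/lam.
  have -> : lam * (X / lam) = X by rewrite mulrC divfK// gt_eqF.
  have ck t : {for t, continuous (fun t => - lpot_xt X (lam * t))}.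
    apply: continuousN; apply: (continuous_comp (f := fun z => lam * z)).
      exact: has_deriv_cont (has_deriv_lam b t).
    by apply: lpot_xt_cont_t; exact: gap_gt0.
  have cqk x t : 0 <= t <= b ->
      {for t, continuous (fun t => q x t * - lpot_xt X (lam * t))}.
    by move=> tb; apply: continuousM; [exact: cq|exact: ck].
  have cqkZ x K t : 0 <= t <= b ->
      {for t, continuous (fun t => K * (q x t * - lpot_xt X (lam * t)))}.
    by move=> tb; apply: continuousM; [exact: cst_continuous|exact: cqk].
  rewrite -RintegralZl//; last exact: (integrable_itv (cqk c)).
  rewrite -RintegralZl//; last exact: (integrable_itv (cqk s)).
  rewrite -RintegralB//; [|exact: (integrable_itv (cqkZ c A))|exact: (integrable_itv (cqkZ s B))].
  move=> /le_trans; apply; rewrite le_eqVlt; apply/orP; left; apply/eqP.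
  by apply: eq_Rintegral => t _; ring.
Qed.

Lemma strip_normal_deriv_ge0 c : 0 <= qt c 0.
Proof.
have := @normal_deriv_comb_ge0 1 0 c c; rewrite mul1r mul0r subr0; apply.
by move=> eta eta0; rewrite mul1r mul0r subr0 (kernel_average_ge0 b0 qH).
Qed.

Lemma strip_harnack_right c s : c <= s -> qt s 0 <= expR (lam * (s - c)) * qt c 0.
Proof.
move=> cs; have := @normal_deriv_comb_ge0 (expR (lam * (s - c))) 1 c s.
rewrite mul1r subr_ge0; apply => eta eta0.
by rewrite mul1r subr_ge0 (kernel_average_harnack b0 qH).
Qed.

End normal_derivative.

(** The case s < c is the case c < s for the reflected function q(- x, t). *)
Lemma strip_harnack (b : R) (q qx qt qxx : R -> R -> R) (c s : R) : 0 < b ->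
  strip_harmonic b q qx qt qxx ->
  (forall x, q x 0 = 0) -> (forall x, 0 <= q x b) ->
  qt s 0 <= expR (pi / b * `|s - c|) * qt c 0.
Proof.
move=> b0 qH q_0 q_b; have [cs|sc] := leP c s.
  by rewrite ger0_norm ?subr_ge0//; exact: (strip_harnack_right b0 qH).
have := @strip_harnack_right b _ _ _ _ b0 (strip_harmonic_reflect qH)
  (fun x => q_0 (- x)) (fun x => q_b (- x)) (- c) (- s).
by rewrite lerN2 !opprK addrC distrC gtr0_norm ?subr_gt0//; apply; exact: ltW.
Qed.

End harnack.

(** * Potentials of finitely many zeros *)

Section charges.
Context {R : realType}.
Implicit Types (x t y phi : R).

Lemma gapN x t : gap x (- t) = gap x t.
Proof. by rewrite /gap cosN. Qed.

Lemma lpotN x t : lpot x (- t) = lpot x t.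
Proof. by rewrite /lpot gapN. Qed.

Lemma lpot_tN x t : lpot_t x (- t) = - lpot_t x t.
Proof. by rewrite /lpot_t gapN sinN mulNr. Qed.

Lemma lpot_xxN x t : lpot_xx x (- t) = lpot_xx x t.
Proof. by rewrite /lpot_xx gapN cosN. Qed.

Lemma lpot_xNx x t : lpot_x (- x) t = - lpot_x x t.
Proof. by rewrite /lpot_x /gap chN shN mulNr. Qed.

Lemma gap_ge (m x t : R) : cos t <= 1 - m -> m <= gap x t.
Proof. by rewrite /gap; have := ch_ge1 x; lra. Qed.

Lemma has_deriv_shift (f : R -> R) df a z :
  has_deriv f (z + a) df -> has_deriv (fun u => f (u + a)) z df.
Proof.
move=> Df; have Da := has_derivD (has_deriv_id z) (has_deriv_cst a z).
by apply: (has_deriv_eq (has_deriv_comp Da Df)); rewrite addr0 mul1r.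
Qed.

Lemma has_deriv_shiftN (f : R -> R) df a z :
  has_deriv f (a - z) df -> has_deriv (fun u => f (a - u)) z (- df).
Proof.
move=> Df; have Da := has_derivB (has_deriv_cst a z) (has_deriv_id z).
by apply: (has_deriv_eq (has_deriv_comp Da Df)); rewrite sub0r mulN1r.
Qed.

Lemma cont_shift (f : R -> R) a z : {for z + a, continuous f} ->
  {for z, continuous (fun u => f (u + a))}.
Proof.
move=> cf; apply: (continuous_comp (f := fun u => u + a)) => //.
exact: has_deriv_cont (has_derivD (has_deriv_id z) (has_deriv_cst a z)).
Qed.

Lemma cont_shiftN (f : R -> R) a z : {for a - z, continuous f} ->
  {for z, continuous (fun u => f (a - u))}.
Proof.
move=> cf; apply: (continuous_comp (f := fun u => a - u)) => //.
exact: has_deriv_cont (has_derivB (has_deriv_cst a z) (has_deriv_id z)).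
Qed.

Variables (b m : R).
Hypotheses (b0 : 0 < b) (m0 : 0 < m).

(** A zero at angle [phi] stays away from all the rays at angle [- t] that occur
    below. *)
Definition off_sector phi := forall t, 0 <= t <= 2 * b -> cos (t + phi) <= 1 - m.

(** With [phi] and [- phi] together this is, up to a factor 4, the contribution of a
    zero to - u_t(x, t). *)
Lemma strip_lpot_t y phi : off_sector phi ->
  strip_harmonic b (fun x t => - lpot_t (x + y) (t + phi))
    (fun x t => - lpot_xt (x + y) (t + phi))
    (fun x t => lpot_xx (x + y) (t + phi))
    (fun x t => - lpot_xxt (x + y) (t + phi)).
Proof.
move=> Hphi.
have mg x t : 0 <= t <= b -> m <= gap (x + y) (t + phi).
  move=> /andP[t0 tb]; apply: gap_ge; apply: Hphi; rewrite t0/=.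
  by rewrite (le_trans tb)// ler_peMl// ?ler1n// ltW.
have g0 x t (tb : 0 <= t <= b) := lt_le_trans m0 (mg x t tb).
split.
- move=> x t tb; apply: has_derivN; apply: (has_deriv_shift (f := lpot_t^~ (t + phi))).
  exact: lpot_t_derive_x (g0 x t tb).
- move=> x t tb; apply: has_derivN; apply: (has_deriv_shift (f := lpot_xt^~ (t + phi))).
  exact: lpot_xt_derive_x (g0 x t tb).
- move=> x t tb; rewrite -[lpot_xx _ _]opprK; apply: has_derivN.
  apply: has_deriv_shift; exact: lpot_t_derive_t (g0 x t tb).
- move=> x t tb; rewrite opprK.
  apply: has_deriv_shift; exact: lpot_xx_derive_t (g0 x t tb).
- move=> x t tb; apply: continuousN; apply: cont_shift.
  exact: lpot_xt_cont_t (g0 x t tb).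
- move=> x t tb; apply: continuousN; apply: cont_shift.
  exact: lpot_xxt_cont_t (g0 x t tb).
- exists ((1 + 2 / m) ^+ 2 + (1 + 2 / m) ^+ 3) => x t tb.
  have m2 : 0 <= 1 + 2 / m by rewrite addr_ge0// divr_ge0// ltW.
  rewrite !normrN; split.
  + by rewrite (le_trans (lpot_xt_bound m0 (mg x t tb)))// lerDl exprn_ge0.
  + by rewrite (le_trans (lpot_xx_bound m0 (mg x t tb)))// lerDl exprn_ge0.
  + by rewrite (le_trans (lpot_xxt_bound m0 (mg x t tb)))// lerDr exprn_ge0.
Qed.

(** With [phi] and [- phi] together this is, up to a factor 4, the contribution of a
    zero to u(x, b - t) - u(x, b + t). *)
Lemma strip_lpot_reflect y phi : off_sector phi ->
  strip_harmonic b
    (fun x t => lpot (x + y) (b + phi - t) - lpot (x + y) (t + (b + phi)))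
    (fun x t => lpot_x (x + y) (b + phi - t) - lpot_x (x + y) (t + (b + phi)))
    (fun x t => - lpot_t (x + y) (b + phi - t) - lpot_t (x + y) (t + (b + phi)))
    (fun x t => lpot_xx (x + y) (b + phi - t) - lpot_xx (x + y) (t + (b + phi))).
Proof.
move=> Hphi.
have m1 x t : 0 <= t <= b -> m <= gap (x + y) (b + phi - t).
  move=> /andP[t0 tb]; apply: gap_ge.
  have -> : b + phi - t = b - t + phi by ring.
  by apply: Hphi; apply/andP; split; lra.
have m2 x t : 0 <= t <= b -> m <= gap (x + y) (t + (b + phi)).
  move=> /andP[t0 tb]; apply: gap_ge; rewrite addrA.
  by apply: Hphi; apply/andP; split; lra.
have g1 x t (tb : 0 <= t <= b) := lt_le_trans m0 (m1 x t tb).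
have g2 x t (tb : 0 <= t <= b) := lt_le_trans m0 (m2 x t tb).
split.
- move=> x t tb; apply: has_derivB.
  + apply: (has_deriv_shift (f := lpot^~ (b + phi - t))).
    exact: lpot_derive_x (g1 x t tb).
  + apply: (has_deriv_shift (f := lpot^~ (t + (b + phi)))).
    exact: lpot_derive_x (g2 x t tb).
- move=> x t tb; apply: has_derivB.
  + apply: (has_deriv_shift (f := lpot_x^~ (b + phi - t))).
    exact: lpot_x_derive_x (g1 x t tb).
  + apply: (has_deriv_shift (f := lpot_x^~ (t + (b + phi)))).
    exact: lpot_x_derive_x (g2 x t tb).
- move=> x t tb; apply: has_derivB.
  + apply: has_deriv_shiftN; exact: lpot_derive_t (g1 x t tb).
  + apply: has_deriv_shift; exact: lpot_derive_t (g2 x t tb).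
- move=> x t tb.
  have H := has_derivB (has_derivN (has_deriv_shiftN (lpot_t_derive_t (g1 x t tb))))
    (has_deriv_shift (lpot_t_derive_t (g2 x t tb))).
  by apply: (has_deriv_eq H); ring.
- move=> x t tb; apply: continuousB.
  + apply: cont_shiftN; exact: has_deriv_cont (lpot_x_derive_t (g1 x t tb)).
  + apply: cont_shift; exact: has_deriv_cont (lpot_x_derive_t (g2 x t tb)).
- move=> x t tb; apply: continuousB.
  + apply: cont_shiftN; exact: has_deriv_cont (lpot_xx_derive_t (g1 x t tb)).
  + apply: cont_shift; exact: has_deriv_cont (lpot_xx_derive_t (g2 x t tb)).
- set K := 1 + 2 / m; exists (2 * K + 2 * K ^+ 2) => x t tb.
  have K0 : 0 <= K by rewrite addr_ge0// divr_ge0// ltW.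
  have K2 : 0 <= 2 * K ^+ 2 by rewrite mulr_ge0// exprn_ge0.
  have K1 : 0 <= 2 * K by rewrite mulr_ge0.
  have := lpot_x_bound m0 (m1 x t tb); have := lpot_x_bound m0 (m2 x t tb).
  have := lpot_t_bound m0 (m1 x t tb); have := lpot_t_bound m0 (m2 x t tb).
  have := lpot_xx_bound m0 (m1 x t tb); have := lpot_xx_bound m0 (m2 x t tb).
  rewrite -/K => *; split; rewrite (le_trans (ler_normB _ _))// ?normrN.
  + by rewrite -[leLHS]addr0 lerD// mulr2n mulrDl !mul1r lerD.
  + by rewrite -[leLHS]addr0 lerD// mulr2n mulrDl !mul1r lerD.
  + by rewrite -[leLHS]add0r lerD// mulr2n mulrDl !mul1r lerD.
Qed.

End charges.

(** The pairs in [s] are the logarithms (y, phi) of the zeros e^(y + i phi).  Each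
    is taken with both signs of [phi], which makes the potential even in [t]; then
    [modulus_le] compares 4 log |f(e^(x + i t))|, up to a term affine in [x], for
    t = 2 b and t = 0. *)
Section charge_sums.
Context {R : realType}.
Variables (b m : R) (s : seq (R * R)).
Hypotheses (b0 : 0 < b) (m0 : 0 < m).
Hypothesis soff : List.Forall
  (fun z => off_sector b m z.2 /\ off_sector b m (- z.2)) s.
Hypothesis modulus_le : forall x,
  \sum_(z <- s) (lpot (x - z.1) (2 * b + z.2) + lpot (x - z.1) (2 * b - z.2))
  <= \sum_(z <- s) (lpot (x - z.1) z.2 + lpot (x - z.1) z.2).

(** For the zeros of [f] these are twice u_xx(x, 0), and twice u_x(x, 0) up to an
    additive constant. *)
Definition curvature x := \sum_(z <- s) lpot_xx (x - z.1) z.2.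
Definition slope x := \sum_(z <- s) lpot_x (x - z.1) z.2.

Let normal_deriv x t :=
  \sum_(z <- s) (- lpot_t (x - z.1) (t + z.2) + - lpot_t (x - z.1) (t - z.2)).

(** The strip result for u(x, b - t) - u(x, b + t). *)
Let normal_deriv_ge0 x : 0 <= normal_deriv x b.
Proof.
have H := strip_harmonic_sum (fun z Pz => strip_harmonicD
  (strip_lpot_reflect m0 (- z.1) (proj1 Pz))
  (strip_lpot_reflect m0 (- z.1) (proj2 Pz))) soff.
have := strip_normal_deriv_ge0 b0 H _ _ x => /=.
move=> /(_ _)/(_ _); rewrite -(pmulr_rge0 (normal_deriv x b) (ltr0Sn R 1)).
have -> : 2 * normal_deriv x b = \sum_(i <- s)
     (- lpot_t (x - i.1) (b + i.2 - 0) - lpot_t (x - i.1) (0 + (b + i.2)) +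
      (- lpot_t (x - i.1) (b - i.2 - 0) - lpot_t (x - i.1) (0 + (b - i.2)))).
  rewrite /normal_deriv mulr_sumr; apply: eq_bigr => z _.
  by rewrite !subr0 !add0r; ring.
apply.
- by move=> y; rewrite big1// => z _; rewrite !subr0 !add0r !subrr addr0.
- move=> y; have := modulus_le y; rewrite -subr_ge0 -sumrB.
  congr (0 <= _); apply: eq_bigr => z _.
  have -> : b + z.2 - b = z.2 by ring.
  have -> : b - z.2 - b = - z.2 by ring.
  have -> : b + (b + z.2) = 2 * b + z.2 by ring.
  have -> : b + (b - z.2) = 2 * b - z.2 by ring.
  by rewrite lpotN; ring.
Qed.

Let strip_normal_deriv : strip_harmonic b normal_deriv
  (fun x t => \sum_(z <- s) (- lpot_xt (x - z.1) (t + z.2) + - lpot_xt (x - z.1) (t - z.2)))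
  (fun x t => \sum_(z <- s) (lpot_xx (x - z.1) (t + z.2) + lpot_xx (x - z.1) (t - z.2)))
  (fun x t => \sum_(z <- s) (- lpot_xxt (x - z.1) (t + z.2) + - lpot_xxt (x - z.1) (t - z.2))).
Proof.
exact: (strip_harmonic_sum (fun z Pz => strip_harmonicD
  (strip_lpot_t b0 m0 (- z.1) (proj1 Pz))
  (strip_lpot_t b0 m0 (- z.1) (proj2 Pz))) soff).
Qed.

Let normal_deriv_0 x : normal_deriv x 0 = 0.
Proof.
by rewrite /normal_deriv big1// => z _; rewrite add0r sub0r lpot_tN opprK addNr.
Qed.

Let curvatureE x : \sum_(z <- s) (lpot_xx (x - z.1) (0 + z.2) + lpot_xx (x - z.1) (0 - z.2))
  = 2 * curvature x.
Proof.
rewrite /curvature mulr_sumr; apply: eq_bigr => z _.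
by rewrite add0r sub0r lpot_xxN; ring.
Qed.

Lemma curvature_ge0 x : 0 <= curvature x.
Proof.
rewrite -(pmulr_rge0 _ (ltr0Sn R 1)) -curvatureE.
exact: (strip_normal_deriv_ge0 b0 strip_normal_deriv normal_deriv_0 normal_deriv_ge0).
Qed.

Lemma curvature_harnack x : curvature x <= expR (pi / b * `|x|) * curvature 0.
Proof.
rewrite -(ler_pM2l (ltr0Sn R 1)) [leRHS]mulrCA -!curvatureE -[in leRHS](subr0 x).
exact: (strip_harnack _ _ b0 strip_normal_deriv normal_deriv_0 normal_deriv_ge0).
Qed.

Lemma slope_deriv x : has_deriv slope x (curvature x).
Proof.
rewrite /slope /curvature; elim: s soff => [_|z l IH /List.Forall_cons_iff [[Pz _] /IH Hl]].
  rewrite big_nil; have -> : (fun x => \sum_(z <- [::]) lpot_x (x - z.1) z.2) = fun=> 0 :> R.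
    by apply/funext => y; rewrite big_nil.
  exact: has_deriv_cst.
have g0 : 0 < gap (x - z.1) z.2.
  apply: (lt_le_trans m0); apply: gap_ge; rewrite -[z.2]add0r; apply: Pz.
  by rewrite lexx mulr_ge0// ltW.
rewrite big_cons.
have -> : (fun x => \sum_(i <- z :: l) lpot_x (x - i.1) i.2) =
    (fun x => lpot_x (x - z.1) z.2 + \sum_(i <- l) lpot_x (x - i.1) i.2).
  by apply/funext => y; rewrite big_cons.
apply: has_derivD Hl; apply: (has_deriv_shift (f := lpot_x^~ z.2)).
exact: lpot_x_derive_x g0.
Qed.

Let lam : R := pi / b.
Let lam0 : 0 < lam. Proof. by rewrite divr_gt0// pi_gt0. Qed.

(** [curvature] is the derivative of [slope] and grows at most like e^(lam |x|), so
    [slope] increases no faster than the primitive of this exponential. *)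
Lemma slope_increment_le (L : R) : 0 <= L ->
  slope L - slope (- L) <= 2 * expR (lam * L) / lam * curvature 0.
Proof.
move=> L0; have V0 := curvature_ge0 0.
have Dexp x : has_deriv (fun x => expR (lam * x)) x (lam * expR (lam * x)).
  have D := has_derivZ lam (has_deriv_id x); rewrite mulr1 in D.
  exact: has_deriv_comp D (has_deriv_expR _).
pose k := curvature 0 / lam.
have lk : lam * k = curvature 0 by rewrite /k mulrC divfK// gt_eqF.
have k0 : 0 <= k by rewrite divr_ge0// ltW.
have right : slope L - k * expR (lam * L) <= slope 0 - k * expR (lam * 0).
  apply: (deriv_le0_le (f := fun x => slope x - k * expR (lam * x))
    (df := fun x => curvature x - k * (lam * expR (lam * x))) L0) => x /andP[x0 _].
    exact: has_derivB (slope_deriv x) (has_derivZ k (Dexp x)).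
  rewrite subr_le0 mulrA (mulrC k) lk mulrC.
  by have := curvature_harnack x; rewrite ger0_norm.
have DN x : has_deriv (fun z : R => - z) x (- 1) by exact: has_derivN (has_deriv_id x).
have left : - slope (- L) - k * expR (lam * L) <= - slope (- 0) - k * expR (lam * 0).
  apply: (deriv_le0_le (f := fun x => - slope (- x) - k * expR (lam * x))
    (df := fun x => curvature (- x) - k * (lam * expR (lam * x))) L0) => x /andP[x0 _].
    have H := has_derivB (has_derivN (has_deriv_comp (DN x) (slope_deriv (- x))))
      (has_derivZ k (Dexp x)).
    by apply: (has_deriv_eq H); ring.
  rewrite subr_le0 mulrA (mulrC k) lk mulrC.
  by have := curvature_harnack (- x); rewrite normrN ger0_norm.
have -> : 2 * expR (lam * L) / lam * curvature 0 = 2 * (k * expR (lam * L)).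
  by rewrite /k; ring.
move: right left; rewrite mulr0 expR0 mulr1 oppr0.
by move: (slope L) (slope (- L)) (slope 0) (k * _) => u v w z; lra.
Qed.

(** The right-hand side is smallest for cos t = -1, where it is th (x / 2). *)
Lemma sh_div_ch_le (x t : R) : 0 <= x -> 0 < gap x t ->
  (expR x - 1) / (expR x + 1) <= lpot_x x t.
Proof.
move=> x0 g0.
have e1 : 1 <= expR x by rewrite -expR0 ler_expR.
have -> : (expR x - 1) / (expR x + 1) = sh x / (ch x + 1).
  rewrite /sh /ch expRN; have e0 : expR x != 0 by rewrite gt_eqF// expR_gt0.
  have e2 : expR x + 1 != 0 by rewrite gt_eqF//; lra.
  pose w := (expR x + 1) / (2 * expR x).
  have w0 : w != 0 by rewrite mulf_neq0// invr_eq0 mulf_neq0.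
  rewrite -[LHS]mulr1 -[X in _ * X = _](divff w0) mulf_div /w.
  by congr (_ / _); field; rewrite ?e0 ?e2.
rewrite ler_wpM2l ?sh_ge0// lef_pV2 ?posrE//.
  by rewrite /gap lerD2l lerNl cos_geN1.
by have := ch_ge1 x; lra.
Qed.

Lemma expR_frac_le (x y : R) : x <= y ->
  (expR x - 1) / (expR x + 1) <= (expR y - 1) / (expR y + 1).
Proof.
move=> xy; have : expR x <= expR y by rewrite ler_expR.
have := expR_gt0 x; have := expR_gt0 y; move: (expR x) (expR y) => u v v0 u0 uv.
rewrite ler_pdivrMr; last by lra.
by rewrite mulrAC ler_pdivlMr; [nra|lra].
Qed.

(** A zero contributes at least th ((L - y) / 2) + th ((L + y) / 2), by
    [sh_div_ch_le]; both terms are nonnegative, and one of L - y and L + y is at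
    least [L]. *)
Lemma slope_increment_ge (L : R) : 0 <= L -> List.Forall (fun z => `|z.1| <= L) s ->
  (size s)%:R * ((expR L - 1) / (expR L + 1)) <= slope L - slope (- L).
Proof.
move=> L0; rewrite /slope -sumrB.
elim: s soff => [_ _|z l IH /List.Forall_cons_iff [[Pz _] /IH Hl]
    /List.Forall_cons_iff [zL /Hl {}Hl]].
  by rewrite mul0r big_nil.
rewrite big_cons /= -natr1 mulrDl mul1r addrC lerD//.
have g0 x : 0 < gap x z.2.
  apply: (lt_le_trans m0); apply: gap_ge; rewrite -[z.2]add0r; apply: Pz.
  by rewrite lexx mulr_ge0// ltW.
rewrite -opprD lpot_xNx opprK.
move: zL; rewrite ler_norml => /andP[zL1 zL2].
have pos x : 0 <= x -> 0 <= lpot_x x z.2.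
  by move=> x0; rewrite divr_ge0 ?sh_ge0// ltW.
have A0 : 0 <= L - z.1 by lra.
have B0 : 0 <= L + z.1 by lra.
have [z0|z0] := leP 0 z.1.
  rewrite -[leLHS]add0r lerD ?pos//.
  by rewrite (le_trans _ (sh_div_ch_le B0 (g0 _)))// expR_frac_le// lerDl.
rewrite -[leLHS]addr0 lerD ?pos//.
by rewrite (le_trans _ (sh_div_ch_le A0 (g0 _)))// expR_frac_le// lerDl oppr_ge0 ltW.
Qed.

End charge_sums.

(** * Zeros of a polynomial with nonnegative coefficients *)

Section log_modulus.
Context {R : realType}.
Implicit Types (x y t phi : R) (z w : R[i]).

Definition cexp x t : R[i] := (expR x * cos t) +i* (expR x * sin t).

Lemma cexpX x t k : cexp x t ^+ k = cexp (k%:R * x) (k%:R * t).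
Proof.
elim: k => [|k IH]; first by rewrite expr0 !mul0r /cexp expR0 cos0 sin0 mulr1 mulr0.
rewrite exprS IH -natr1 !mulrDl !mul1r /cexp expRD cosD sinD.
apply/eqP; rewrite eq_complex /=; apply/andP; split; apply/eqP; ring.
Qed.

Lemma norm_cexp x t : `|cexp x t| = (expR x)%:C.
Proof.
rewrite normc_def /=; congr (_%:C).
have -> : (expR x * cos t) ^+ 2 + (expR x * sin t) ^+ 2 = expR x ^+ 2.
  by rewrite -[RHS]mulr1 -(cos2Dsin2 t); ring.
by rewrite sqrtr_sqr gtr0_norm ?expR_gt0.
Qed.

(** The squared modulus as a real number, to which [ln] applies. *)
Definition sqmod z : R := complex.Re z ^+ 2 + complex.Im z ^+ 2.

Lemma sqmodE z : (sqmod z)%:C = `|z| ^+ 2.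
Proof. by rewrite -add_Re2_Im2. Qed.

Lemma sqmodM z w : sqmod (z * w) = sqmod z * sqmod w.
Proof. by apply: complexI; rewrite rmorphM /= !sqmodE normrM exprMn. Qed.

Lemma sqmod1 : sqmod 1 = 1.
Proof. by apply: complexI; rewrite sqmodE normr1 expr1n. Qed.

Lemma sqmod_prod (I : Type) (s : seq I) (F : I -> R[i]) :
  sqmod (\prod_(i <- s) F i) = \prod_(i <- s) sqmod (F i).
Proof. exact: (big_morph sqmod sqmodM sqmod1). Qed.

Lemma sqmod_dist x t y phi :
  sqmod (cexp x t - cexp y phi) = 2 * expR (x + y) * gap (x - y) (t - phi).
Proof.
rewrite /sqmod /cexp /= /gap cosB /ch opprB !expRD !expRN.
have cx := cos2Dsin2 t; have cy := cos2Dsin2 phi.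
have -> : 2 * (expR x * expR y) *
    ((expR x / expR y + expR y / expR x) / 2 - (cos t * cos phi + sin t * sin phi)) =
    expR x ^+ 2 * (cos t ^+ 2 + sin t ^+ 2)
    + expR y ^+ 2 * (cos phi ^+ 2 + sin phi ^+ 2) -
     2 * (expR x * expR y) * (cos t * cos phi + sin t * sin phi).
  rewrite cx cy !mulr1; field.
  by rewrite !gt_eqF// ?expR_gt0.
ring.
Qed.

(** A logarithm of [z], as a pair (log |z|, argument). *)
Definition log_polar z : R * R :=
  (ln (Num.sqrt (sqmod z)), carg z).

Lemma log_polarK z : z != 0 -> cexp (log_polar z).1 (log_polar z).2 = z.
Proof.
move=> z0; have [_ [r r0 zr]] := cargP z0.
rewrite /log_polar /=.
have -> : Num.sqrt (sqmod z) = r.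
  rewrite zr /sqmod /=.
  have -> : (r * cos (carg z)) ^+ 2 + (r * sin (carg z)) ^+ 2 = r ^+ 2.
    by rewrite -[RHS]mulr1 -(cos2Dsin2 (carg z)); ring.
  by rewrite sqrtr_sqr gtr0_norm.
by rewrite /cexp lnK ?posrE// -zr.
Qed.

Lemma norm_log_polar z : z != 0 -> `|z| = (expR (log_polar z).1)%:C.
Proof. by move=> z0; rewrite -{1}(log_polarK z0) norm_cexp. Qed.

End log_modulus.

Section pgf_roots.
Context {R : realType}.
Variables (n : nat) (p : nat -> R).
Hypothesis p_ge0 : forall k, 0 <= p k.
Hypothesis p0_gt0 : 0 < p 0.
Hypothesis pn_gt0 : 0 < p n.
Hypothesis p_sum : \sum_(k < n.+1) p k = 1.

Let f : {poly R[i]} := \poly_(k < n.+1) (p k)%:C.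

(** The [j]-th derivative of x |-> f(e^x), the moment generating function. *)
Definition mgf_deriv (j : nat) (x : R) :=
  \sum_(k < n.+1) p k * k%:R ^+ j * expR (k%:R * x).

Lemma mgf_derivP j x : has_deriv (mgf_deriv j) x (mgf_deriv j.+1 x).
Proof.
have -> : mgf_deriv j = \sum_(k < n.+1) (fun x => p k * k%:R ^+ j * expR (k%:R * x)).
  by apply/funext => y; rewrite fct_sumE.
apply: is_derive_sum => k.
have D := has_derivZ k%:R (has_deriv_id x).
have := has_derivZ (p k * k%:R ^+ j) (has_deriv_comp D (has_deriv_expR _)).
by move=> H; apply: (has_deriv_eq H); rewrite mulr1 exprS; ring.
Qed.

Lemma mgf_gt0 x : 0 < mgf_deriv 0 x.
Proof.
rewrite /mgf_deriv (bigD1 ord_max)//= ltr_pwDl//.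
  by rewrite expr0 mulr1 mulr_gt0// expR_gt0.
by apply: sumr_ge0 => k _; rewrite expr0 mulr1 mulr_ge0// expR_ge0.
Qed.

Lemma horner_real x : f.[cexp x 0] = (mgf_deriv 0 x)%:C.
Proof.
rewrite horner_poly /mgf_deriv rmorph_sum /=; apply: eq_bigr => k _.
rewrite cexpX mulr0 /cexp cos0 sin0 mulr0 mulr1 expr0 mulr1.
by rewrite complexr0 -rmorphM.
Qed.

(** The triangle inequality: the coefficients are nonnegative. *)
Lemma sqmod_horner_le x t : sqmod f.[cexp x t] <= sqmod f.[cexp x 0].
Proof.
rewrite -lecR !sqmodE; apply: lerXn2r; rewrite ?nnegrE ?normr_ge0//.
have -> : `|f.[cexp x 0]| = f.[cexp x 0].
  by rewrite horner_real ger0_norm// ler0c ltW// mgf_gt0.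
rewrite !horner_poly (le_trans (ler_norm_sum _ _ _))//; apply: ler_sum => k _.
rewrite normrM ger0_norm ?ler0c// normrX norm_cexp ler_wpM2l ?ler0c//.
rewrite -[leRHS]ger0_norm ?normrX ?norm_cexp//.
by rewrite /cexp cos0 sin0 mulr0 mulr1 complexr0 -rmorphXn /= ler0c exprn_ge0// expR_ge0.
Qed.

(** [f] splits over the complex numbers, and none of its zeros is 0 because [p 0] is
    not; so they can be listed by their logarithms. *)
Lemma pgf_roots : exists s : seq (R * R),
  [/\ size s = n,
      List.Forall (fun u => exists zeta,
        [/\ root f zeta, zeta != 0 & u = log_polar zeta]) s &
      forall x t, sqmod f.[cexp x t] = p n ^+ 2 *
        \prod_(u <- s) (2 * expR (x + u.1) * gap (x - u.1) (t - u.2))].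
Proof.
have Cneq0 (a : R) : 0 < a -> a%:C != 0.
  by move=> a0; rewrite -(rmorph0 (real_complex R)) (inj_eq (@complexI R)) gt_eqF.
have pn0 := Cneq0 _ pn_gt0.
have szf : size f = n.+1 by rewrite size_poly_eq.
have lcf : lead_coef f = (p n)%:C by rewrite /lead_coef szf coef_poly ltnSn.
have f0 z : root f z -> z != 0.
  apply: contraTneq => ->; rewrite rootE horner_coef0 coef_poly /=; exact: Cneq0.
have [r fr] := closed_field_poly_normal f; rewrite lcf in fr.
have rootr z : root f z = (z \in r) by rewrite fr rootZ// root_prod_XsubC.
have szr : size r = n.
  by apply: succn_inj; rewrite -szf fr size_scale// size_prod_XsubC.
exists (map log_polar r); split.
- by rewrite size_map.
- have : {subset r <= r} by [].
  elim: {1 3}r => [|z l IH] lr; first exact: List.Forall_nil.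
  rewrite /=; apply: List.Forall_cons; last first.
    by apply: IH => w wl; apply: lr; rewrite inE wl orbT.
  have zr : root f z by rewrite rootr lr// mem_head.
  by exists z; split => //; exact: f0.
- move=> x t; rewrite fr hornerZ sqmodM horner_prod sqmod_prod big_map.
  congr (_ * _); first by rewrite /sqmod /= expr0n addr0.
  rewrite big_seq [RHS]big_seq; apply: eq_bigr => z zr.
  by rewrite hornerXsubC -sqmod_dist log_polarK// f0// rootr.
Qed.

Section log_derivative.
Variables (s : seq (R * R)) (m : R).
Hypothesis m0 : 0 < m.
Hypothesis s_size : size s = n.
Hypothesis s_prod : forall x t, sqmod f.[cexp x t] = p n ^+ 2 *
  \prod_(u <- s) (2 * expR (x + u.1) * gap (x - u.1) (t - u.2)).

Let ln_prod (l : seq (R * R)) x t : List.Forall (fun u => 0 < gap (x - u.1) (t - u.2)) l ->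
  0 < \prod_(u <- l) (2 * expR (x + u.1) * gap (x - u.1) (t - u.2)) /\
  ln (\prod_(u <- l) (2 * expR (x + u.1) * gap (x - u.1) (t - u.2))) =
  (size l)%:R * x + \sum_(u <- l) (ln 2 + u.1) + \sum_(u <- l) lpot (x - u.1) (t - u.2).
Proof.
elim: l => [_|u l IH /List.Forall_cons_iff [g0 /IH [P0 E]]].
  by rewrite !big_nil ltr01 ln1 mul0r !addr0.
have F0 : 0 < 2 * expR (x + u.1) * gap (x - u.1) (t - u.2).
  by rewrite mulr_gt0// mulr_gt0// expR_gt0.
rewrite !big_cons; split; first exact: mulr_gt0.
rewrite lnM ?posrE// E lnM ?posrE ?mulr_gt0 ?expR_gt0//.
rewrite lnM ?posrE ?expR_gt0// expRK /= -natr1 /lpot; ring.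
Qed.

Lemma ln_sqmod x t : List.Forall (fun u => 0 < gap (x - u.1) (t - u.2)) s ->
  ln (sqmod f.[cexp x t]) = ln (p n ^+ 2) + (n%:R * x + \sum_(u <- s) (ln 2 + u.1))
    + \sum_(u <- s) lpot (x - u.1) (t - u.2).
Proof.
move=> /ln_prod [P0 E]; rewrite s_prod lnM ?posrE ?exprn_gt0// E s_size; ring.
Qed.

Hypothesis s_gap : List.Forall (fun u => cos u.2 <= 1 - m) s.

Let gap0 x : List.Forall (fun u => 0 < gap (x - u.1) (0 - u.2)) s.
Proof.
apply: List.Forall_impl s_gap => u Hu; apply: (lt_le_trans m0).
by apply: gap_ge; rewrite sub0r cosN.
Qed.

Lemma ln_mgf x : 2 * ln (mgf_deriv 0 x) =
  ln (p n ^+ 2) + (n%:R * x + \sum_(u <- s) (ln 2 + u.1))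
    + \sum_(u <- s) lpot (x - u.1) u.2.
Proof.
have -> : \sum_(u <- s) lpot (x - u.1) u.2 = \sum_(u <- s) lpot (x - u.1) (0 - u.2).
  by apply: eq_bigr => u _; rewrite sub0r lpotN.
rewrite -ln_sqmod// horner_real /sqmod /= expr0n addr0 lnXn ?mgf_gt0//.
by rewrite mulr_natl.
Qed.

(** Differentiate [ln_mgf]. *)
Lemma mgf_log_deriv x :
  2 * (mgf_deriv 1 x / mgf_deriv 0 x) = n%:R + slope s x.
Proof.
have D1 : has_deriv (fun x => 2 * ln (mgf_deriv 0 x)) x
    (2 * (mgf_deriv 1 x / mgf_deriv 0 x)).
  exact: has_derivZ (has_deriv_comp (mgf_derivP 0 x) (has_deriv_ln (mgf_gt0 x))).
apply: (has_deriv_unique D1).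
under eq_fun do rewrite ln_mgf.
have DS : has_deriv (fun x => \sum_(u <- s) lpot (x - u.1) u.2) x (slope s x).
  rewrite /slope; elim: s s_gap => [_|u l IH /List.Forall_cons_iff [g0 /IH Hl]].
    rewrite big_nil; under eq_fun do rewrite big_nil.
    exact: has_deriv_cst.
  rewrite big_cons; under eq_fun do rewrite big_cons.
  apply: has_derivD Hl; apply: (has_deriv_shift (f := lpot^~ u.2)).
  by apply: lpot_derive_x; apply: (lt_le_trans m0); exact: gap_ge.
have D2 := has_derivD (has_derivD (has_deriv_cst (ln (p n ^+ 2)) x)
  (has_derivD (has_derivZ n%:R (has_deriv_id x))
    (has_deriv_cst (\sum_(u <- s) (ln 2 + u.1)) x))) DS.
by apply: (has_deriv_eq D2); rewrite add0r addr0 mulr1.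
Qed.

(** Differentiate [mgf_log_deriv] at 0, where the moment generating function is 1. *)
Lemma mgf_curvature : has_deriv (slope s) 0 (curvature s 0) ->
  curvature s 0 = 2 * (mgf_deriv 2 0 - mgf_deriv 1 0 ^+ 2).
Proof.
move=> DS.
have M0 : mgf_deriv 0 0 = 1.
  rewrite -[RHS]p_sum; apply: eq_bigr => k _.
  by rewrite expr0 mulr0 expR0 !mulr1.
have M1 : mgf_deriv 0 0 != 0 by rewrite M0 oner_eq0.
have D1 := has_derivZ 2 (has_deriv_div M1 (mgf_derivP 1 0) (mgf_derivP 0 0)).
have D2 := has_derivD (has_deriv_cst n%:R (0 : R)) DS.
have E : (fun x => 2 * (mgf_deriv 1 x / mgf_deriv 0 x)) = (fun x => n%:R + slope s x).
  by apply/funext => x; exact: mgf_log_deriv.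
have := has_deriv_unique D2; rewrite add0r; move=> /(_ _ _); apply.
rewrite -E; apply: (has_deriv_eq D1).
by rewrite M0 expr1n; field.
Qed.

End log_derivative.

End pgf_roots.

(** * Variance bounds from zero-free sectors *)

Section sector.
Context {R : realType}.

(** On the circle, t + phi stays at distance at least [eta] from 0: for phi >= 0 it
    may pass [pi], but then 2 pi - (t + phi) >= pi - t >= eta. *)
Lemma cos_away (eta phi t : R) : 0 <= eta -> 0 <= t -> eta + t <= `|phi| ->
  `|phi| <= pi -> cos (t + phi) <= cos eta.
Proof.
move=> eta0 t0 etat phipi; have p0 := pi_ge0 R.
have cos_le (u v : R) : 0 <= u -> u <= v -> v <= pi -> cos v <= cos u.
  move=> u0 uv vpi; rewrite leNgt ltr_cos ?in_itv/= -?leNgt//.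
    by rewrite vpi (le_trans u0).
  by rewrite u0 (le_trans uv).
case: (ger0P phi) etat phipi => [phi0|phi0] etat phipi.
  have [tpi|tpi] := leP (t + phi) pi; first by apply: cos_le => //; lra.
  have -> : cos (t + phi) = cos (pi *+ 2 - (t + phi)).
    by rewrite -cosN -[in LHS](cosD2pi (- (t + phi))) addrC.
  by rewrite mulr2n; apply: cos_le => //; lra.
have -> : cos (t + phi) = cos (- phi - t) by rewrite -cosN; congr cos; ring.
by apply: cos_le => //; lra.
Qed.

Variables (n : nat) (p : nat -> R) (delta delta' L : R).
Hypothesis p_ge0 : forall k, 0 <= p k.
Hypothesis p0_gt0 : 0 < p 0.
Hypothesis pn_gt0 : 0 < p n.
Hypothesis p_sum : \sum_(k < n.+1) p k = 1.
Hypotheses (d0 : 0 < delta') (dd : delta' < delta) (L0 : 0 <= L).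
Hypothesis roots_in : forall zeta : R[i], zeta != 0 ->
  root (\poly_(k < n.+1) (p k)%:C) zeta ->
  delta <= `|(log_polar zeta).2| /\ `|(log_polar zeta).1| <= L.

(** Upper and lower bounds for the growth of the tilted mean over [-L, L], combined.
    The strip has width delta' / 2. *)
Lemma zero_free_sector_variance :
  n%:R * ((expR L - 1) / (expR L + 1)) <=
  2 * expR (2 * pi / delta' * L) / (2 * pi / delta') *
  (2 * (mgf_deriv n p 2 0 - mgf_deriv n p 1 0 ^+ 2)).
Proof.
have [s [s_size s_roots s_prod]] := pgf_roots p0_gt0 pn_gt0.
have s_pos : List.Forall (fun u : R * R => [/\ delta <= `|u.2|, `|u.2| <= pi & `|u.1| <= L]) s.
  apply: List.Forall_impl s_roots => u [z [rz z0 ->]].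
  have [H1 H2] := roots_in z0 rz; split => //.
  by have [/andP[h1 h2] _] := cargP z0; rewrite ler_norml h1 h2.
pose b := delta' / 2.
have b0 : 0 < b by rewrite divr_gt0.
have b2 : 2 * b = delta' by rewrite /b mulrC divfK.
(* shifts by at most [2 * b] keep every zero at angle at least [eta] *)
pose eta : R := Num.min (delta - delta') pi.
pose m : R := 1 - cos eta.
have eta0 : 0 < eta by rewrite lt_min subr_gt0 dd pi_gt0.
have eta_le : eta <= delta - delta' by rewrite ge_min lexx.
have eta_pi : eta <= pi by rewrite ge_min lexx orbT.
have m0 : 0 < m.
  rewrite subr_gt0 -[ltRHS](@cos0 R) ltr_cos ?in_itv//= ?lexx ?pi_ge0//.
  by rewrite (ltW eta0).
have off (u : R * R) (t : R) : [/\ delta <= `|u.2|, `|u.2| <= pi & `|u.1| <= L] ->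
    0 <= t <= delta' ->
    cos (t + u.2) <= 1 - m /\ cos (t + - u.2) <= 1 - m.
  move=> [u1 u2 _] /andP[t0 t1]; rewrite /m subKr; split.
    by apply: cos_away => //; [exact: ltW|lra].
  by apply: cos_away; rewrite ?normrN//; [exact: ltW|lra].
have soff : List.Forall (fun z => off_sector b m z.2 /\ off_sector b m (- z.2)) s.
  apply: List.Forall_impl s_pos => u Hu; split => t; rewrite b2 => td;
  by have [] := off u t Hu td.
have d00 : 0 <= (0 : R) <= delta' by rewrite lexx ltW.
have d11 : 0 <= delta' <= delta' by rewrite lexx ltW.
have modulus_le x :
  \sum_(z <- s) (lpot (x - z.1) (2 * b + z.2) + lpot (x - z.1) (2 * b - z.2))
  <= \sum_(z <- s) (lpot (x - z.1) z.2 + lpot (x - z.1) z.2).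
  have lpotE t :
      List.Forall (fun u => 0 < gap (x - u.1) (t - u.2)) s ->
    \sum_(z <- s) lpot (x - z.1) (t - z.2) <= \sum_(z <- s) lpot (x - z.1) z.2.
    move=> Ht.
    have H0 : List.Forall (fun u => 0 < gap (x - u.1) (0 - u.2)) s.
      apply: List.Forall_impl s_pos => u Hu; apply: (lt_le_trans m0); apply: gap_ge.
      by have [] := off u 0 Hu d00.
    have -> : \sum_(z <- s) lpot (x - z.1) z.2 = \sum_(z <- s) lpot (x - z.1) (0 - z.2).
      by apply: eq_bigr => z _; rewrite sub0r lpotN.
    have E0 := ln_sqmod pn_gt0 s_size s_prod H0.
    have Et := ln_sqmod pn_gt0 s_size s_prod Ht.
    have P0 : 0 < sqmod (\poly_(k < n.+1) (p k)%:C).[cexp x t].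
      rewrite s_prod mulr_gt0 ?exprn_gt0//.
      elim: s Ht {s_size s_roots s_prod s_pos soff H0 E0 Et} => [_|u l IH].
        by rewrite big_nil.
      move=> /List.Forall_cons_iff [g0 /IH Hl].
      by rewrite big_cons mulr_gt0// mulr_gt0// mulr_gt0// expR_gt0.
    have : ln (sqmod (\poly_(k < n.+1) (p k)%:C).[cexp x t]) <=
        ln (sqmod (\poly_(k < n.+1) (p k)%:C).[cexp x 0]).
      have P1 := sqmod_horner_le p_ge0 pn_gt0 x t.
      by rewrite ler_ln ?posrE// (lt_le_trans P0).
    by rewrite E0 Et lerD2l.
  rewrite !big_split /= lerD//.
    under eq_bigr do rewrite -lpotN opprD.
    apply: lpotE; apply: List.Forall_impl s_pos => u Hu; apply: (lt_le_trans m0).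
    apply: gap_ge; rewrite b2 -opprD cosN.
    by have [] := off u delta' Hu d11.
  apply: lpotE; apply: List.Forall_impl s_pos => u Hu; apply: (lt_le_trans m0).
  by apply: gap_ge; rewrite b2; have [] := off u delta' Hu d11.
have s_gap : List.Forall (fun u => cos u.2 <= 1 - m) s.
  apply: List.Forall_impl s_pos => u Hu.
  by have [] := off u 0 Hu d00; rewrite add0r.
have s_L : List.Forall (fun z => `|z.1| <= L) s.
  by apply: List.Forall_impl s_pos => u [].
have lamE : pi / b = 2 * pi / delta'.
  by rewrite /b; field; rewrite gt_eqF.
have VE := mgf_curvature p_ge0 pn_gt0 p_sum m0 s_size s_prod s_gap
  (slope_deriv b0 m0 soff 0).
rewrite -VE -lamE -s_size.
apply: (le_trans (slope_increment_ge b0 m0 soff L0 s_L)).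
exact: (slope_increment_le b0 m0 soff modulus_le L0).
Qed.

End sector.

Section moments.
Context {R : realType}.
Context d (T : measurableType d) (P : probability T R) (n : nat) (X : {RV P >-> nat}).
Hypothesis Xn : forall t, (X t <= n)%N.

Let A k := X @^-1` [set k].

Let mA k : measurable (A k).
Proof. by rewrite -[A k]setTI; exact: (measurable_funP X). Qed.

Let indicL1 k (g : R) : (g \o* \1_(A k) : T -> R) \in Lfun P 1.
Proof.
apply: Lfun_scale; first exact: lexx.
by apply/Lfun1_integrable; exact: integrable_indic.
Qed.

Let decomp (g : nat -> R) : (fun t => g (X t)) =
  \sum_(h <- map (fun k : 'I_n.+1 => g k \o* \1_(A k) : T -> R) (index_enum 'I_n.+1)) h.
Proof.
apply/funext => t; rewrite big_map fct_sumE.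
have Xt : (X t < n.+1)%N by rewrite ltnS.
rewrite (bigD1 (Ordinal Xt))//= big1 ?addr0.
  by rewrite indicE mem_set// mul1r.
move=> k kX; rewrite indicE memNset ?mul0r// => /= H.
by move/eqP: kX; apply; apply: val_inj; rewrite /= -H.
Qed.

Lemma Lfun1_nat (g : nat -> R) : (fun t => g (X t)) \in Lfun P 1.
Proof.
rewrite decomp big_map; apply: rpred_sum => k _; exact: indicL1.
Qed.

(** A function of [X] is a combination of the indicators of the events X = k. *)
Lemma expectation_nat (g : nat -> R) :
  ('E_P[fun t => g (X t)] =
    (\sum_(k < n.+1) fine (P (X @^-1` [set (k : nat)])) * g k)%R%:E)%E.
Proof.
rewrite decomp expectation_sum; last by move=> h /mapP[k _ ->].
rewrite big_map -sumEFin; apply: eq_bigr => k _.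
rewrite expectationZl; last by apply/Lfun1_integrable; exact: integrable_indic.
rewrite expectation_indic// mulrC EFinM fineK//.
exact: (fin_num_measure P _ (mA k)).
Qed.

Lemma pmf_sum : \sum_(k < n.+1) fine (P (X @^-1` [set (k : nat)])) = 1.
Proof.
have := expectation_nat (fun=> 1); rewrite expectation_cst => -[->].
by apply: eq_bigr => k _; rewrite mulr1.
Qed.

Lemma variance_nat :
  ('V_P[fun t => (X t)%:R] =
   (mgf_deriv n (fun k => fine (P (X @^-1` [set k]))) 2 0 -
    mgf_deriv n (fun k => fine (P (X @^-1` [set k]))) 1 0 ^+ 2)%:E)%E.
Proof.
have mE (j : nat) : mgf_deriv n (fun k => fine (P (X @^-1` [set k]))) j 0 =
    \sum_(k < n.+1) fine (P (X @^-1` [set (k : nat)])) * k%:R ^+ j.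
  by apply: eq_bigr => k _; rewrite mulr0 expR0 mulr1.
rewrite /variance covarianceE; [|exact: Lfun1_nat|exact: Lfun1_nat|]; last first.
  exact: (Lfun1_nat (fun k => k%:R * k%:R)).
have E2 := expectation_nat (fun k => k%:R * k%:R).
have E1 := expectation_nat (fun k => k%:R).
rewrite [X in (X - _)%E]E2 E1 !mE -EFinM -EFinB expr2.
have -> : \sum_(k < n.+1) fine (P (X @^-1` [set (k : nat)])) * (k%:R * k%:R) =
  \sum_(k < n.+1) fine (P (X @^-1` [set (k : nat)])) * k%:R ^+ 2 :> R.
  by apply: eq_bigr => k _; rewrite expr2.
have -> : \sum_(k < n.+1) fine (P (X @^-1` [set (k : nat)])) * k%:R ^+ 1 =
  \sum_(k < n.+1) fine (P (X @^-1` [set (k : nat)])) * k%:R :> R.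
  by apply: eq_bigr => k _; rewrite expr1.
by [].
Qed.

End moments.

Section constants.
Context {R : realType}.

(** The bound is wanted at delta' = delta.  With delta' = delta / (1 + k) and [k] at
    most the reciprocal of the exponent 2 pi L / delta, the exponential grows by a
    factor at most e. *)
Lemma variance_constant (delta eps rho v : R) (n : nat) :
  0 < delta -> delta <= pi -> 0 < eps < 1 -> 1 + eps <= rho -> 0 <= v ->
  (forall delta', 0 < delta' -> delta' < delta ->
     let L := ln rho + delta in
     n%:R * ((expR L - 1) / (expR L + 1)) <=
     2 * expR (2 * pi / delta' * L) / (2 * pi / delta') * (2 * v)) ->
  pi * expR (- (1 + 2 * pi)) / (2 * (2 + pi)) *
    (Num.max eps delta * delta^-1 * rho `^ (- (2 * pi / delta)) * n%:R) <= v.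
Proof.
move=> d0 dpi /andP[e0 e1] erho v0 H.
have pi0 := pi_gt0 R; have pi2 := pi_ge2 R.
have rho1 : 1 < rho by lra.
have rho0 : 0 < rho by lra.
have lr0 : 0 < ln rho by exact: ln_gt0.
set L := ln rho + delta in H.
have L0 : 0 < L by rewrite /L; lra.
pose lam := 2 * pi / delta.
have lam0 : 0 < lam by rewrite divr_gt0// mulr_gt0.
have lamd : lam * delta = 2 * pi by rewrite /lam divfK// gt_eqF.
have lL0 : 0 < 1 + lam * L by rewrite addr_gt0// mulr_gt0.
pose k := (1 + lam * L)^-1.
have k0 : 0 < k by rewrite invr_gt0.
have k1 : 0 < 1 + k by rewrite addr_gt0.
have d'0 : 0 < delta / (1 + k) by rewrite divr_gt0.
have d'd : delta / (1 + k) < delta by rewrite ltr_pdivrMr// ltr_pMr// ltrDl.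
have {H} := H _ d'0 d'd => /=.
have -> : 2 * pi / (delta / (1 + k)) = lam * (1 + k).
  by rewrite /lam; field; rewrite !gt_eqF.
pose mm := Num.max eps delta.
have mm0 : 0 < mm by rewrite lt_max e0.
have mmpi : mm <= pi by rewrite ge_max dpi andbT; lra.
have eL : 1 + mm <= expR L.
  rewrite /L expRD lnK ?posrE//; have ed := expR_ge1Dx delta.
  rewrite /mm; case: (leP eps delta) => _; move: (expR delta) ed => w ed; nra.
have F : mm / (2 + pi) <= (expR L - 1) / (expR L + 1).
  move: (expR L) eL => w eL; rewrite ler_pdivrMr; last by lra.
  by rewrite mulrAC ler_pdivlMr; [nra|lra].
have El : expR (lam * (1 + k) * L) <= expR 1 * (expR (lam * ln rho) * expR (2 * pi)).
  rewrite -!expRD ler_expR.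
  have -> : lam * (1 + k) * L = lam * ln rho + lam * delta + k * (lam * L).
    by rewrite /L; ring.
  have : k * (lam * L) <= 1.
    by rewrite /k mulrC ler_pdivrMr// mul1r lerDr.
  rewrite lamd; move: (k * _) (lam * ln rho) => u w; lra.
have -> : rho `^ (- (2 * pi / delta)) = (expR (lam * ln rho))^-1.
  by rewrite /powR gt_eqF// -/lam -expRN mulNr.
have -> : expR (- (1 + 2 * pi)) = (expR 1)^-1 / expR (2 * pi) :> R.
  by rewrite -!expRN -expRD opprD.
move=> H.
set A := expR (lam * ln rho) in El *; set B := expR (2 * pi) in El *.
set e := expR 1 in El *.
have A0 : 0 < A := expR_gt0 _; have B0 : 0 < B := expR_gt0 _.
have ee0 : 0 < e := expR_gt0 _.
have n0 : 0 <= n%:R :> R by rewrite ler0n.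
have {}H : n%:R * (mm / (2 + pi)) <= 4 * (e * (A * B)) / lam * v.
  apply: (le_trans (ler_wpM2l n0 F)); apply: (le_trans H).
  have h : expR (lam * (1 + k) * L) / (lam * (1 + k)) <= e * (A * B) / lam.
    have lk0 : 0 < lam * (1 + k) by exact: mulr_gt0.
    have lk1 : lam <= lam * (1 + k) by rewrite ler_pMr// lerDl ltW.
    by apply: ler_pM; rewrite ?expR_ge0 ?invr_ge0 ?(ltW lk0)// lef_pV2.
  have := ler_wpM2l (mulr_ge0 (ler0n R 4) v0) h.
  by congr (_ <= _); ring.
have E : pi * (e^-1 / B) / (2 * (2 + pi)) * (mm / delta / A * n%:R) =
    n%:R * (mm / (2 + pi)) / (4 * (e * (A * B)) / lam).
  rewrite /lam; field; rewrite !gt_eqF//; lra.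
by rewrite -/mm E ler_pdivrMr ?[v * _]mulrC// divr_gt0// !mulr_gt0.
Qed.

End constants.

Theorem theorem24 (R : realType) :
  exists2 c : R, 0 < c &
    forall (d : measure_display) (T : measurableType d) (P : probability T R)
      (n : nat) (X : {RV P >-> nat}),
      (forall t : T, (X t <= n)%N) ->
      (0 < P (X @^-1` [set 0%N]) * P (X @^-1` [set n]))%E ->
    forall eps delta rho : R,
      0 < eps < 1 -> 0 < delta -> 1 + eps <= rho ->
      (forall zeta : R[i], root (pgf P n X) zeta ->
         delta <= `|carg zeta| /\ (rho^-1)%:C <= `|zeta| <= rho%:C) ->
      ((c * (Num.max eps delta * delta^-1 * rho `^ (- (2 * pi / delta)) * n%:R))%:E
         <= 'V_P[(fun t => (X t)%:R : R)])%E.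
Proof.
exists (pi * expR (- (1 + 2 * pi)) / (2 * (2 + pi))).
  have pi0 := pi_gt0 R.
  by rewrite divr_gt0// ?mulr_gt0// ?expR_gt0// addr_gt0.
move=> d T P n X Xn P0n eps delta rho eps01 d0 rho_ge zeros.
rewrite (variance_nat Xn).
pose p k := fine (P (X @^-1` [set k])).
have p_ge0 k : 0 <= p k by rewrite fine_ge0.
have PE k : P (X @^-1` [set k]) = (p k)%:E.
  rewrite /p fineK// fin_num_measure//.
  by rewrite -[X in measurable X]setTI; exact: (measurable_funP X).
have p_sum : \sum_(k < n.+1) p k = 1 by exact: pmf_sum.
have /andP[p0 pn] : (0 < p 0%N) && (0 < p n).
  move: P0n; rewrite !PE -EFinM lte_fin => P0n.
  have := p_ge0 0%N; have := p_ge0 n; rewrite !le_eqVlt.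
  case/predU1P => [h|->]; first by move: P0n; rewrite -h mulr0 ltxx.
  by case/predU1P => [h|->]; first by move: P0n; rewrite -h mul0r ltxx.
have rho0 : 0 < rho by case/andP: eps01 => *; lra.
rewrite lee_fin; have V0 : 0 <= mgf_deriv n p 2 0 - mgf_deriv n p 1 0 ^+ 2.
  by rewrite -lee_fin -(variance_nat Xn) variance_ge0.
have [n0|n0] := posnP n.
  have nR : n%:R = 0 :> R by rewrite n0.
  by rewrite nR !mulr0.
have roots_in zeta : zeta != 0 -> root (\poly_(k < n.+1) (p k)%:C) zeta ->
    delta <= `|(log_polar zeta).2| /\ `|(log_polar zeta).1| <= ln rho.
  move=> z0 /zeros [dz /andP[z1 z2]]; split => //.
  move: z1 z2; rewrite norm_log_polar// !lecR => z1 z2.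
  rewrite ler_norml -ler_expR -[X in _ && X]ler_expR expRN lnK ?posrE//.
  exact/andP.
have dpi : delta <= pi.
  have [[|u s] [sz s_roots _]] := pgf_roots p0 pn.
    by move: sz n0 => /= <-.
  case/List.Forall_cons_iff: s_roots => [[z [rz z0 _]] _].
  have [dz _] := roots_in z z0 rz.
  by apply: (le_trans dz); rewrite ler_norml; have [] := cargP z0.
apply: variance_constant => // delta' d'0 d'd.
apply: (zero_free_sector_variance p_ge0 p0 pn p_sum d'0 d'd).
  by rewrite addr_ge0 ?(ltW d0)// ln_ge0//; case/andP: eps01 => *; lra.
move=> z z0 /(roots_in z z0) [dz yz]; split => //.
by rewrite (le_trans yz)// lerDl ltW.
Qed.
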